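(* Let $X_1$, $X_2$ and $Y$ be Banach function spaces over $\mathbb{R}^n$ and let $0\le\alpha<2n$. Suppose there is a constant $C$ such that for every cube $Q\subset\mathbb{R}^n$, $$|Q|^{-\frac{\alpha}{n}}\,\|\chi_Q\|_{Y'}\,\|\chi_Q\|_{X_1}\|\chi_Q\|_{X_2}\le C|Q| .$$ Let $T$ be a bilinear operator defined on $X_1\times X_2$ which can be represented by $$T(f,g)(x)=\int_{\mathbb{R}^n}\int_{\mathbb{R}^n}K(x-y,x-z)f(y)g(z)\,dy\,dz\qquad\text{for all } x\notin\operatorname{supp}(f)\cap\operatorname{supp}(g),$$ where $K$ is a homogeneous kernel on $\mathbb{R}^{2n}$ of degree $-(2n-\alpha)$, i.e. $K(\lambda u)=\lambda^{-(2n-\alpha)}K(u)$ for all $\lambda>0$, $u\in\mathbb{R}^{2n}\setminus\{0\}$. Suppose further that there exists a ball $B\subset\mathbb{R}^{2n}$ on which $\frac1K$ has an absolutely convergent Fourier series. Let $b\in L^1_{\mathrm{loc}}(\mathbb{R}^n)$. If for $j=1$ or $j=2$ the bilinear commutator $[b,T]_j$ is bounded from $X_1\times X_2$ to $Y$, then $b\in BMO(\mathbb{R}^n)$.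
   Context: Functions are real-valued; cubes have sides parallel to the coordinate axes; $|Q|$ is Lebesgue measure. A Banach function space $X$ is a Banach space of measurable functions over $\mathbb{R}^n$ whose norm satisfies, for all $f,g\in X$: (1) $\|f\|_X=\||f|\|_X$; (2) if $|f|\le|g|$ a.e. then $\|f\|_X\le\|g\|_X$; (3) if $\{f_k\}\subset X$ and $|f_k|$ increases to $|f|$ a.e., then $\|f_k\|_X$ increases to $\|f\|_X$; (4) if $E\subset\mathbb{R}^n$ is bounded (measurable), then $\|\chi_E\|_X<\infty$; (5) if $E$ is bounded, then $\int_E|f(x)|\,dx\le C\|f\|_X$ with $C=C(E,X)$. The associate space $X'$ is the Banach function space with norm $\|g\|_{X'}=\sup\{\int_{\mathbb{R}^n}|f(x)g(x)|\,dx:\|f\|_X\le 1\}$; one has $\|f\|_X\approx\sup_{\|g\|_{X'}\le1}\int fg\,dx$ and $(X')'=X$. The bilinear commutators are $$[b,T]_1(f,g)(x)=b(x)T(f,g)(x)-T(bf,g)(x),\qquad [b,T]_2(f,g)(x)=b(x)T(f,g)(x)-T(f,bg)(x).$$ ''$[b,T]_j$ is bounded from $X_1\times X_2$ to $Y$'' (written $[b,T]_j:X_1\times X_2\to Y$) means there is a constant $A$ with $\|[b,T]_j(f,g)\|_Y\le A\|f\|_{X_1}\|g\|_{X_2}$ for all $f\in X_1$, $g\in X_2$; it is implicit that $T$ also acts on the pairs $(bf,g)$, respectively $(f,bg)$, with the same integral representation. ''$\frac1K$ has an absolutely convergent Fourier series on $B$'' means that $\frac{1}{K(u)}=\sum_j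 a_je^{i\nu_j\cdot u}$ for $u\in B$, with $\nu_j\in\mathbb{R}^{2n}$ and $\sum_j|a_j|<\infty$. $b\in BMO(\mathbb{R}^n)$ means $\sup_Q\frac1{|Q|}\int_Q|b(x)-b_Q|\,dx<\infty$, where $b_Q=\frac1{|Q|}\int_Qb$. *)

(* Defs.v *)
From HB Require Import structures.
From mathcomp Require Import all_boot all_order all_algebra.
From mathcomp Require Import all_classical all_reals all_analysis.
From mathcomp Require Import complex.

Set Implicit Arguments.
Unset Strict Implicit.
Unset Printing Implicit Defensive.

Import Order.TTheory GRing.Theory Num.Theory.
Import numFieldNormedType.Exports.

Local Open Scope classical_set_scope.
Local Open Scope ring_scope.
Local Open Scope ereal_scope.

(* MathComp-Analysis provides Lebesgue measure on R only.  Lebesgue measure on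
   R^n is obtained in two steps: the n-fold product of one-dimensional Lebesgue
   measure on the product sigma-algebra of n.-tuple R, and then its
   Caratheodory completion, transported to row vectors. *)

Section borel_lebesgue_tuple.
Context {R : realType}.
Local Notation mR := (measurableTypeR R).

Definition tuple_glue n (p : mR * n.-tuple mR) : n.+1.-tuple mR :=
  [tuple of p.1 :: p.2].

Lemma measurable_tuple_glue n : measurable_fun setT (@tuple_glue n).
Proof. exact: measurable_cons. Qed.

Section glue_measure.
Variables (n : nat) (m : {sigma_finite_measure set (n.-tuple mR) -> \bar R}).

Definition glue_measure : set (n.+1.-tuple mR) -> \bar R :=
  pushforward (@lebesgue_measure R \x m) (@tuple_glue n).

Let glue_measure0 : glue_measure set0 = 0.
Proof. by rewrite /glue_measure /pushforward preimage_set0 measure0. Qed.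

Let glue_measure_ge0 A : 0 <= glue_measure A.
Proof. by rewrite /glue_measure /pushforward; exact: measure_ge0. Qed.

Let glue_measure_sigma_additive : semi_sigma_additive glue_measure.
Proof.
move=> F mF tF mUF; rewrite /glue_measure /pushforward preimage_bigcup.
have mpre (A : set (n.+1.-tuple mR)) :
    measurable A -> measurable (@tuple_glue n @^-1` A).
  by move=> mA; rewrite -[X in measurable X]setTI; exact: measurable_tuple_glue.
apply: measure_semi_sigma_additive.
- by move=> k; exact: mpre.
- apply/trivIsetP => /= i j _ _ ij; rewrite -preimage_setI.
  by move/trivIsetP : tF => /(_ _ _ _ _ ij) ->//; rewrite preimage_set0.
- by rewrite -preimage_bigcup; exact: mpre.
Qed.

HB.instance Definition _ := isMeasure.Build _ _ _ glue_measure
  glue_measure0 glue_measure_ge0 glue_measure_sigma_additive.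

Let glue_measure_sigma_finite : sigma_finite setT glue_measure.
Proof.
have /sigma_finiteP[F [TF ndF Foo]] := sigma_finiteT (@lebesgue_measure R).
have /sigma_finiteP[G [TG ndG Goo]] := sigma_finiteT m.
have TFG : setT = \bigcup_k (F k `*` G k).
  rewrite -setXTT TF TG predeqE => -[x y]; split.
    move=> [/= [i _ Fix] [k _ Gky]]; exists (maxn i k) => //; split.
    - by move: x Fix; exact/subsetPset/ndF/leq_maxl.
    - by move: y Gky; exact/subsetPset/ndG/leq_maxr.
  by move=> [i _ []/= ? ?]; split; exists i.
pose split (t : n.+1.-tuple mR) : mR * n.-tuple mR :=
  (thead t, [tuple of behead t]).
have splitK : cancel split (@tuple_glue n).
  by move=> t; rewrite /tuple_glue/= [RHS]tuple_eta.
have glueK : cancel (@tuple_glue n) split.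
  move=> [x t]; rewrite /split (_ : thead _ = x); last first.
    by rewrite /thead (tnth_nth x).
  by congr (_, _); exact/val_inj.
have msplit : measurable_fun setT split.
  apply/measurable_fun_pairP; split; last exact: measurable_behead.
  exact: measurable_tnth.
exists (fun k => split @^-1` (F k `*` G k)).
  by rewrite -preimage_bigcup -TFG preimage_setT.
move=> k; have [mFk Fkoo] := Foo k; have [mGk Gkoo] := Goo k; split.
  by rewrite -[X in measurable X]setTI; apply: msplit => //; exact: measurableX.
rewrite /glue_measure /pushforward -comp_preimage.
rewrite (_ : split \o _ = id); last by apply/funext => p; exact: glueK.
by rewrite preimage_id product_measure1E// lte_mul_pinfty// ge0_fin_numE.
Qed.

HB.instance Definition _ := Measure_isSigmaFinite.Build _ _ _ glue_measure
  glue_measure_sigma_finite.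

End glue_measure.

Fixpoint borel_lebesgue n : {sigma_finite_measure set (n.-tuple mR) -> \bar R} :=
  if n is k.+1 then glue_measure (borel_lebesgue k) else \d_[tuple].

End borel_lebesgue_tuple.

Section lebesgue_row_vectors.
Context {R : realType} (n : nat).
Local Notation mR := (measurableTypeR R).
Local Notation mu := (borel_lebesgue (R := R) n).

Definition tuple_of_row (x : 'rV[R]_n) : n.-tuple mR :=
  [tuple x ord0 i | i < n].

Definition lebesgue_outer (A : set 'rV[R]_n) : \bar R :=
  (mu^*)%mu (tuple_of_row @` A).

Let lebesgue_outer0 : lebesgue_outer set0 = 0.
Proof. by rewrite /lebesgue_outer image_set0 outer_measure0. Qed.

Let lebesgue_outer_ge0 A : 0 <= lebesgue_outer A.
Proof. exact: outer_measure_ge0. Qed.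

Let le_lebesgue_outer : {homo lebesgue_outer : A B / A `<=` B >-> A <= B}.
Proof. by move=> A B AB; apply: le_outer_measure; exact: image_subset. Qed.

Let lebesgue_outer_sigma_subadditive : sigma_subadditive lebesgue_outer.
Proof.
by move=> F; rewrite /lebesgue_outer image_bigcup;
  exact: outer_measure_sigma_subadditive.
Qed.

HB.instance Definition _ := isOuterMeasure.Build R 'rV[R]_n lebesgue_outer
  lebesgue_outer0 lebesgue_outer_ge0 le_lebesgue_outer
  lebesgue_outer_sigma_subadditive.

(* The sigma-algebra put on R^n is that of the Lebesgue measurable sets, so
   that measurable_fun below means Lebesgue measurable. *)
HB.instance Definition _ := @isMeasurable.Build
  (caratheodory_display lebesgue_outer) 'rV[R]_n
  lebesgue_outer.-caratheodory
  (caratheodory_measurable_set0 lebesgue_outer)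
  (@caratheodory_measurable_setC _ _ lebesgue_outer)
  (@caratheodory_measurable_bigcup _ _ lebesgue_outer).

Definition lebesgue : set 'rV[R]_n -> \bar R := lebesgue_outer.

HB.instance Definition _ := isMeasure.Build _ _ _ lebesgue
  lebesgue_outer0 lebesgue_outer_ge0
  (@caratheodory_measure_sigma_additive _ _ lebesgue_outer).

End lebesgue_row_vectors.
Arguments lebesgue {R n}.

Section function_spaces.
Context {R : realType} {n : nat}.
Implicit Types (f g : 'rV[R]_n -> R) (N : ('rV[R]_n -> R) -> \bar R).

(* A function space is given by its norm, extended by +oo to the measurable
   functions outside of the space. *)
Definition in_space N f := measurable_fun setT f /\ N f < +oo.

Record is_banach_function_norm N : Prop := {
  bfn_ge0 : forall f, measurable_fun setT f -> 0 <= N f ;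
  bfn_eq0 : forall f, measurable_fun setT f ->
    N f = 0 <-> {ae lebesgue, forall x, f x = 0%R} ;
  bfnZ : forall (c : R) f, in_space N f ->
    N (fun x => c * f x)%R = `|c|%:E * N f ;
  bfn_triangle : forall f g, in_space N f -> in_space N g ->
    N (fun x => f x + g x)%R <= N f + N g ;
  bfn_complete : forall u : nat -> 'rV[R]_n -> R,
    (forall k, in_space N (u k)) ->
    (forall e : R, (0 < e)%R -> exists k0 : nat, forall k l : nat,
      (k0 <= k)%N -> (k0 <= l)%N -> N (fun x => u k x - u l x)%R < e%:E) ->
    exists f, in_space N f /\
      N (fun x => u k x - f x)%R @[k --> \oo] --> 0 ;
  bfn_abs : forall f, in_space N f -> N f = N (fun x => `|f x|%R) ;
  bfn_le : forall f g, in_space N f -> in_space N g ->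
    {ae lebesgue, forall x, (`|f x| <= `|g x|)%R} -> N f <= N g ;
  bfn_Fatou : forall (u : nat -> 'rV[R]_n -> R) f,
    (forall k, in_space N (u k)) -> measurable_fun setT f ->
    {ae lebesgue, forall x, nondecreasing_seq (fun k => `|u k x|%R) /\
      `|u k x|%R @[k --> \oo] --> `|f x|%R} ->
    nondecreasing_seq (fun k => N (u k)) /\
    N (u k) @[k --> \oo] --> N f ;
  bfn_indic : forall E : set 'rV[R]_n, measurable E -> bounded_set E ->
    N \1_E < +oo ;
  bfn_integral : forall E : set 'rV[R]_n, measurable E -> bounded_set E ->
    exists C : R, forall f, in_space N f ->
      \int[lebesgue]_(x in E) `|f x|%:E <= C%:E * N f }.

Record bfspace := BFSpace {
  bfs_norm :> ('rV[R]_n -> R) -> \bar R ;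
  bfs_normP : is_banach_function_norm bfs_norm }.

Definition associate_norm (X : bfspace) g : \bar R :=
  ereal_sup [set \int[lebesgue]_x `|f x * g x|%:E |
    f in [set f | in_space X f /\ X f <= 1]].

(* The cube with lowest corner a and side length r. *)
Definition cube (a : 'rV[R]_n) (r : R) : set 'rV[R]_n :=
  [set x | forall i, (a ord0 i <= x ord0 i <= a ord0 i + r)%R].

Definition volume (Q : set 'rV[R]_n) : R := fine (lebesgue Q).

Definition locally_L1 f := measurable_fun setT f /\
  forall D : set 'rV[R]_n, compact D ->
    \int[lebesgue]_(x in D) `|f x|%:E < +oo.

Definition average f (Q : set 'rV[R]_n) : R :=
  ((volume Q)^-1 * \int[lebesgue]_(x in Q) f x)%R.

Definition BMO f := locally_L1 f /\
  ereal_sup [set ((volume (cube p.1 p.2))^-1)%:E *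
                 \int[lebesgue]_(x in cube p.1 p.2)
                    `|f x - average f (cube p.1 p.2)|%:E |
    p in [set p : 'rV[R]_n * R | (0 < p.2)%R]] < +oo.

Definition supp f : set 'rV[R]_n := closure [set x | f x != 0%R].

End function_spaces.
Arguments bfspace : clear implicits.

Section bilinear_operators.
Context {R : realType} {n : nat}.
Local Notation fct := ('rV[R]_n -> R).
Implicit Types (b f g : fct) (T : fct -> fct -> fct) (X Y : bfspace R n).

(* The elements of the spaces are classes for a.e. equality, hence the a.e.
   identities for T, which acts on representatives. *)
Record bilinear_on X1 X2 T : Prop := {
  bilinear_ae : forall f f' g g',
    in_space X1 f -> in_space X1 f' -> in_space X2 g -> in_space X2 g' ->
    {ae lebesgue, forall x, f x = f' x} ->
    {ae lebesgue, forall x, g x = g' x} ->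
    {ae lebesgue, forall x, T f g x = T f' g' x} ;
  bilinear_l : forall (c : R) f f' g,
    in_space X1 f -> in_space X1 f' -> in_space X2 g ->
    {ae lebesgue, forall x,
      T (fun y => c * f y + f' y)%R g x = (c * T f g x + T f' g x)%R} ;
  bilinear_r : forall (c : R) f g g',
    in_space X1 f -> in_space X2 g -> in_space X2 g' ->
    {ae lebesgue, forall x,
      T f (fun y => c * g y + g' y)%R x = (c * T f g x + T f g' x)%R} }.

(* The integral of K(x - y, x - z) f(y) g(z) is iterated, in y and then in z.
   Its existence in the Lebesgue sense is made explicit because divergent
   integrals have default values. *)
Definition represented_by (K : 'rV[R]_(n + n) -> R) T f g : Prop :=
  forall x, ~ (supp f `&` supp g) x ->
  let F := fun y z => (K (row_mx (x - y) (x - z)) * f y * g z)%R in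
  [/\ {ae lebesgue, forall z,
         lebesgue.-integrable setT (fun y => (F y z)%:E)},
      lebesgue.-integrable setT (fun z => (\int[lebesgue]_y F y z)%R%:E) &
      T f g x = (\int[lebesgue]_z \int[lebesgue]_y F y z)%R].

Definition commutator1 b T f g : fct :=
  fun x => (b x * T f g x - T (fun y => b y * f y) g x)%R.

Definition commutator2 b T f g : fct :=
  fun x => (b x * T f g x - T f (fun z => b z * g z) x)%R.

Definition bounded_from X1 X2 Y T : Prop :=
  exists A : R, forall f g, in_space X1 f -> in_space X2 g ->
    in_space Y (T f g) /\ Y (T f g) <= A%:E * X1 f * X2 g.

End bilinear_operators.

Section kernels.
Context {R : realType} {m : nat}.
Local Notation C := (R[i] : numFieldType).
Local Open Scope ring_scope.
Implicit Types (K : 'rV[R]_m -> R) (B : set 'rV[R]_m).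

Definition homogeneous (s : R) K := forall (l : R) (u : 'rV[R]_m),
  0 < l -> u != 0 -> K (l *: u) = l `^ s * K u.

(* The norm of 'rV[R]_m in the library is the sup norm, the balls of which
   are cubes. *)
Definition euclidean_ball (c : 'rV[R]_m) (r : R) : set 'rV[R]_m :=
  [set u | Num.sqrt (\sum_i (u ord0 i - c ord0 i) ^+ 2) < r].

Definition dotp (u v : 'rV[R]_m) : R := \sum_i u ord0 i * v ord0 i.

Definition expi (t : R) : C := Complex (cos t) (sin t).

Definition inv_abs_fourier K B := (forall u, B u -> K u != 0) /\
  exists (a : nat -> C) (nu : nat -> 'rV[R]_m),
    cvgn [normed series a] /\
    forall u, B u ->
      series (fun j => a j * expi (dotp (nu j) u)) @ \oo -->
      (Complex (K u)^-1 0 : C).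

End kernels.

(* Main.v *)
(* Choose c = (c1, c2) <> 0 in the ball and a small sup-norm cube of radius d
   around c on which 1/K is a uniform limit of trigonometric polynomials and K is
   bounded.  Given a cube Q of side r, let Q1 and Q2 be its translates by
   -(r/d)c1 and -(r/d)c2.  For x in Q, y in Q1, z in Q2 the point
   (d/r)(x - y, x - z) lies in that small cube, so by homogeneity
   (d/r)^(2n-alpha) is approximated by K(x - y, x - z) times a sum of products
   of bounded functions of x, y and z.  Integrating b(x) - b(y) (or b(x) - b(z))
   against this approximation over Q1 x Q2 expresses b(x) minus the mean of b
   over Q1 (or Q2) through values at x of the commutator on modulated
   characteristic functions; these are controlled by Hoelder's inequality in Y
   and the cube condition on one cube containing Q, Q1 and Q2.  The integral
   representation of T applies at every x in Q because d < |c_i| for some i,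
   so that Q, Q1 and Q2 have no common point. *)
Require Import Defs.
From HB Require Import structures.
From mathcomp Require Import all_boot all_order all_algebra.
From mathcomp Require Import all_classical all_reals all_analysis.
From mathcomp Require Import measurable_realfun complex.
From mathcomp Require Import ring lra.

Set Implicit Arguments.
Unset Strict Implicit.
Unset Printing Implicit Defensive.

Import Order.TTheory GRing.Theory Num.Theory.
Import numFieldNormedType.Exports.

Local Open Scope classical_set_scope.
Local Open Scope ring_scope.
Local Open Scope ereal_scope.

(** * Lebesgue measure on row vectors *)

Arguments tuple_of_row {R n} x.

Section lebesgue_facts.
Context {R : realType} {n : nat}.
Local Notation mR := (measurableTypeR R).

Lemma rowK_tuple : cancel (fun t => \row_i tnth t i) (@tuple_of_row R n).
Proof. by move=> t; apply/eq_from_tnth => i; rewrite tnth_mktuple mxE. Qed.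

Lemma image_tuple_of_row_preimage (A : set (n.-tuple mR)) :
  tuple_of_row @` (tuple_of_row @^-1` A) = A.
Proof.
apply/seteqP; split=> [_ [x Ax <-]//|t At].
by exists (\row_i tnth t i); rewrite /= rowK_tuple.
Qed.

(** Cutting [X] by the preimage of [A], or of its complement, and then taking the image amounts to
    cutting the image of [X], so the Caratheodory criterion transfers from tuples. On measurable
    sets the outer measure is the measure itself. *)
Lemma lebesgue_preimage (A : set (n.-tuple mR)) : measurable A ->
  measurable (tuple_of_row @^-1` A) /\
  lebesgue (tuple_of_row @^-1` A) = borel_lebesgue n A.
Proof.
move=> mA; split; last first.
  rewrite /lebesgue /lebesgue_outer image_tuple_of_row_preimage.
  exact: measurable_mu_extE.
move=> X; rewrite /lebesgue_outer /=.
rewrite (sub_caratheodory _ (sub_sigma_algebra mA) (tuple_of_row @` X)).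
congr (_ + _); congr (_ _); apply/seteqP; split=> t.
- by move=> [[x Xx <-] Ax]; exists x.
- by move=> [x [Xx Ax] <-]; split => //; exists x.
- by move=> [[x Xx <-] Ax]; exists x.
- by move=> [x [Xx Ax] <-]; split => //; exists x.
Qed.

Lemma measurable_tuple_of_row :
  measurable_fun setT (tuple_of_row : 'rV[R]_n -> n.-tuple mR).
Proof.
by move=> _ A mA; rewrite setTI; have [] := lebesgue_preimage mA.
Qed.

Lemma measurable_coord (i : 'I_n) :
  measurable_fun setT (fun x : 'rV[R]_n => x ord0 i : mR).
Proof.
rewrite (_ : (fun x => _) = (fun t : n.-tuple mR => tnth t i) \o tuple_of_row).
  by apply: measurableT_comp; [exact: measurable_tnth|
    exact: measurable_tuple_of_row].
by apply/funext => x /=; rewrite tnth_mktuple.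
Qed.

Lemma measurable_dotp (v : 'rV[R]_n) : measurable_fun setT (dotp v).
Proof.
rewrite /dotp; apply: measurable_sum => i; apply: measurable_funM.
  exact: measurable_cst.
exact: measurable_coord.
Qed.

End lebesgue_facts.

(** * Measure and topology of boxes and cubes *)

Section boxes.
Context {R : realType}.
Local Notation mR := (measurableTypeR R).

Lemma measurable_box n (A : 'I_n -> set mR) : (forall i, measurable (A i)) ->
  measurable [set t : n.-tuple mR | forall i, A i (tnth t i)].
Proof.
move=> mA.
rewrite (_ : [set t | _] =
  \bigcap_(i in [set: 'I_n]) ((fun t => tnth t i) @^-1` A i)).
  apply: fin_bigcap_measurable; first exact: finite_finset.
  by move=> i _; rewrite -[X in measurable X]setTI; apply: measurable_tnth.
by apply/seteqP; split=> t /= At i => [_|]; apply: At.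
Qed.

(** Induction on the dimension: the preimage of a box under [tuple_glue] is a rectangle for the
    product measure. In dimension 0 the Dirac mass matches the empty product. *)
Lemma borel_lebesgue_box n (A : 'I_n -> set mR) : (forall i, measurable (A i)) ->
  borel_lebesgue n [set t | forall i, A i (tnth t i)] =
  \prod_(i < n) lebesgue_measure (A i).
Proof.
elim: n A => [|n IHn] A mA.
  rewrite big_ord0 /= /dirac indicE mem_set//= => -[]//.
rewrite big_ord_recl -IHn; last by move=> i; exact: mA.
rewrite /= /glue_measure /pushforward.
rewrite -product_measure1E//; last first.
  by apply: (measurable_box (A := fun i => A (lift ord0 i))) => i; exact: mA.
congr (_ _); apply/seteqP; split=> -[x t] /=.
  move=> At; split; first by have := At ord0; rewrite (tnth_nth x).
  by move=> i; have := At (lift ord0 i); rewrite !(tnth_nth x).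
move=> [A0 At] i; case: (unliftP ord0 i) => [j|] ->; rewrite !(tnth_nth x)//=.
by have := At j; rewrite (tnth_nth x).
Qed.

End boxes.

Section cubes.
Context {R : realType} {n : nat}.
Local Notation mR := (measurableTypeR R).
Implicit Types (a : 'rV[R]_n) (r : R).

Lemma cubeE a r : cube a r = tuple_of_row @^-1`
  [set t | forall i, `[a ord0 i, (a ord0 i + r)%R]%classic (tnth t i)].
Proof.
by apply/seteqP; split=> x /= ax i; have := ax i; rewrite tnth_mktuple/= in_itv.
Qed.

Lemma measurable_cube a r : measurable (cube a r).
Proof.
rewrite cubeE.
refine (lebesgue_preimage
  (measurable_box (A := fun i => `[a ord0 i, _]%classic) _)).1.
by move=> i; exact: measurable_itv.
Qed.

Lemma lebesgue_cube a r : (0 < r)%R -> lebesgue (cube a r) = (r ^+ n)%:E.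
Proof.
move=> r0; have mI i : measurable (`[a ord0 i, (a ord0 i + r)%R]%classic : set mR).
  exact: measurable_itv.
rewrite cubeE (lebesgue_preimage (measurable_box mI)).2.
rewrite (borel_lebesgue_box mI).
rewrite -[n in RHS]card_ord -prodr_const -prodEFin; apply: eq_bigr => i _.
by rewrite lebesgue_measure_itv/= lte_fin ltrDl r0 -EFinB addrAC subrr add0r.
Qed.

Lemma volume_cube a r : (0 < r)%R -> volume (cube a r) = (r ^+ n)%R.
Proof. by move=> r0; rewrite /volume lebesgue_cube. Qed.

Lemma compact_cube a r : compact (cube a r).
Proof.
exact: (@rV_compact R n (fun i => `[a ord0 i, (a ord0 i + r)%R]%classic)
  (fun i => @segment_compact R _ _)).
Qed.

Lemma closed_cube a r : closed (cube a r).
Proof.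
by apply: compact_closed; [exact: norm_hausdorff|exact: compact_cube].
Qed.

Lemma bounded_cube a r : bounded_set (cube a r).
Proof. by apply: compact_bounded; exact: compact_cube. Qed.

End cubes.

(** * Banach function spaces *)

Lemma measurable_EFin_norm d (T : measurableType d) (R : realType) (D : set T)
    (f : T -> R) :
  measurable_fun D f -> measurable_fun D (fun x => `|f x|%:E).
Proof. by move=> mf; apply/measurable_EFinP; exact: measurableT_comp. Qed.

Section banach_function_spaces.
Import HBNNSimple.
Context {R : realType} {n : nat}.
Implicit Types (X Y : bfspace R n) (E F : set 'rV[R]_n) (f g : 'rV[R]_n -> R).

Lemma in_space_indic X E : measurable E -> bounded_set E -> in_space X \1_E.
Proof.
move=> mE bE; split; first exact: measurable_indic.
exact: (bfn_indic (bfs_normP X)).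
Qed.

Lemma bfs_norm0 X : X (fun=> 0%R) = 0.
Proof.
apply/(bfn_eq0 (bfs_normP X)); first exact: measurable_cst.
exact: aeW.
Qed.

Lemma in_space0 X : in_space X (fun=> 0%R).
Proof. by split; [exact: measurable_cst|rewrite bfs_norm0]. Qed.

Lemma in_spaceD X f g : in_space X f -> in_space X g ->
  in_space X (fun x => f x + g x)%R.
Proof.
move=> Xf Xg; split; first exact: measurable_funD Xf.1 Xg.1.
apply: le_lt_trans (bfn_triangle (bfs_normP X) Xf Xg) _.
by rewrite lte_add_pinfty// ?Xf.2 ?Xg.2.
Qed.

Lemma bfs_norm_ge0 X f : in_space X f -> 0 <= X f.
Proof. by move=> [mf _]; exact: (bfn_ge0 (bfs_normP X)). Qed.

Lemma bfs_norm_fin_num X f : in_space X f -> X f \is a fin_num.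
Proof. by move=> Xf; rewrite ge0_fin_numE ?bfs_norm_ge0// Xf.2. Qed.

Lemma in_spaceZ X c f : in_space X f -> in_space X (fun x => c * f x)%R.
Proof.
move=> Xf; split; first exact: measurable_funM (measurable_cst _) Xf.1.
rewrite (bfnZ (bfs_normP X))// -(fineK (bfs_norm_fin_num Xf)) -EFinM.
exact: ltry.
Qed.

Lemma in_space_sum X I (s : seq I) (h : I -> 'rV[R]_n -> R) :
  (forall i, in_space X (h i)) -> in_space X (fun x => \sum_(i <- s) h i x)%R.
Proof.
move=> Xh; elim: s => [|i s IHs].
  by under eq_fun do rewrite big_nil; exact: in_space0.
by under eq_fun do rewrite big_cons; exact: in_spaceD.
Qed.

(** A simple function is a finite combination of indicators of its fibres. Those over nonzero values
    lie in [E], hence are bounded; the fibre over 0 may be unbounded, but its term vanishes. *)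
Lemma in_space_nnsfun X E (h : {nnsfun 'rV[R]_n >-> R}) : bounded_set E ->
  (forall x, ~ E x -> h x = 0%R) -> in_space X h.
Proof.
move=> bE h0.
rewrite (_ : (h : _ -> _) = (fun x =>
  \sum_(y <- finmap.enum_fset (fset_set (range h)))
    y * \1_(h @^-1` [set y]) x)%R); last first.
  by apply/funext => x; rewrite fimfunE fsbig_finite.
apply: in_space_sum => y; have [->|y0] := eqVneq y 0%R.
  by under eq_fun do rewrite mul0r; exact: in_space0.
apply: in_spaceZ; apply: in_space_indic.
  by rewrite -[X in measurable X]setTI; exact: measurable_funP.
case: bE => M [Mr bM]; exists M; split=> // r Mr' x hx; apply: bM => //.
apply: contrapT => /h0 h0x.
by move/eqP: y0; apply; rewrite -h0x.
Qed.

(* The lattice axiom [bfn_le] compares norms inside the space only; membership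
   of [f] comes from the Fatou property along simple functions. *)
Lemma in_space_dominated X E f : measurable E -> bounded_set E ->
  measurable_fun setT f -> (forall x, `|f x| <= \1_E x)%R ->
  in_space X f /\ X f <= X \1_E.
Proof.
move=> mE bE mf fE.
have mf' : measurable_fun setT (fun x => `|f x|%:E).
  exact: measurable_EFin_norm.
pose u k : 'rV[R]_n -> R := nnsfun_approx measurableT mf' k.
have ucvg x : (fun k => u k x) @ \oo --> `|f x|%R.
  have /fine_cvgP[_] // : (EFin \o (fun k => u k x)) @ \oo --> `|f x|%:E.
  by apply: (cvg_nnsfun_approx measurableT mf') => // y _; rewrite lee_fin.
have und x : nondecreasing_seq (fun k => u k x).
  move=> k l kl; exact/lefP/nd_nnsfun_approx.
have u0 k x : (0 <= u k x)%R by exact: fun_ge0.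
have ule k x : (u k x <= \1_E x)%R.
  apply: le_trans (fE x); rewrite -(cvg_lim (@Rhausdorff R) (ucvg x)).
  by apply: nondecreasing_cvgn_le => //; apply/cvg_ex; eexists; exact: ucvg.
have Xu k : in_space X (u k).
  apply: in_space_nnsfun bE _ => x Ex; apply/eqP.
  rewrite eq_le u0 andbT.
  by have := ule k x; rewrite indicE memNset.
have [_ cvgX] : nondecreasing_seq (fun k => X (u k)) /\
    X (u k) @[k --> \oo] --> X f.
  apply: (bfn_Fatou (bfs_normP X)) => //; apply: aeW => x; split.
    by under eq_fun do rewrite ger0_norm//; exact: und.
  by under eq_fun do rewrite ger0_norm//; exact: ucvg.
have Xf : X f <= X \1_E.
  rewrite -(cvg_lim (@ereal_hausdorff R) cvgX).
  apply: lime_le; first by apply/cvg_ex; eexists; exact: cvgX.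
  apply: nearW => k; apply: (bfn_le (bfs_normP X)) => //.
    exact: in_space_indic.
  by apply: aeW => x; rewrite !ger0_norm// indicE.
by do 2 split => //; exact: le_lt_trans Xf (in_space_indic X mE bE).2.
Qed.

Lemma associate_norm_indic_le X E F : measurable E -> measurable F ->
  E `<=` F -> associate_norm X \1_E <= associate_norm X \1_F.
Proof.
move=> mE mF EF; apply: ge_ereal_sup => _ [f [Xf f1] <-].
apply: (@le_trans _ _ (\int[lebesgue]_x `|f x * \1_F x|%:E)); last first.
  by apply: ereal_sup_ubound; exists f.
have m1 G : measurable G ->
    measurable_fun setT (fun x => `|f x * \1_G x|%:E).
  move=> mG; apply: measurable_EFin_norm.
  apply: measurable_funM Xf.1 _; exact: measurable_indic.
apply: (ge0_le_integral lebesgue measurableT _ (m1 _ mE) (m1 _ mF)) => x _.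
  by rewrite lee_fin.
 rewrite lee_fin !normrM ler_wpM2l// !indicE.
case: (boolP (x \in E)) => [/set_mem/EF/mem_set ->//|_].
by rewrite normr0.
Qed.

Lemma associate_norm_ge0 X g : 0 <= associate_norm X g.
Proof.
apply: ereal_sup_ubound; exists (fun=> 0%R).
  by split; [exact: in_space0|rewrite bfs_norm0].
by under eq_integral do rewrite mul0r normr0; rewrite integral0.
Qed.

(** Hoelder's inequality: if [X f] is nonzero, [f] divided by [X f] is admissible in the supremum;
    otherwise [f] vanishes a.e. *)
Lemma integral_le_associate_norm X f E : measurable E -> in_space X f ->
  \int[lebesgue]_(x in E) `|f x|%:E <= X f * associate_norm X \1_E.
Proof.
move=> mE Xf.
have mf := Xf.1.
have mfE (c : R) : measurable_fun setT (fun x => `|c * f x * \1_E x|%:E).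
  apply: measurable_EFin_norm; apply: measurable_funM; last exact: measurable_indic.
  exact: measurable_funM (measurable_cst _) mf.
rewrite integral_mkcond/= (_ : _ \_ E = fun x => `|1 * f x * \1_E x|%:E); last first.
  apply/funext => x; rewrite patchE indicE mul1r.
  by case: ifPn => _; rewrite ?mulr1// mulr0 normr0.
have [Xf0|Xf0] := eqVneq (X f) 0.
  (* The associate norm may be infinite here; the convention [0 * +oo = 0] makes the right-hand side
     0. *)
  rewrite Xf0 mul0e.
  move/(bfn_eq0 (bfs_normP X) mf) : Xf0 => f0.
  rewrite (ae_eq_integral (cst 0) _ measurableT (mfE 1%R) (measurable_cst _)).
    by rewrite integral_cst ?mul0e.
  by apply: filterS f0 => x /= -> _; rewrite mulr0 mul0r normr0.
have t0 : (0 < fine (X f))%R.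
  by rewrite fine_gt0// lt0e Xf0 bfs_norm_ge0//= Xf.2.
set t := fine (X f) in t0.
have Xft : X f = t%:E by rewrite fineK// bfs_norm_fin_num.
have le1 : \int[lebesgue]_x `|t^-1 * f x * \1_E x|%:E <= associate_norm X \1_E.
  apply: ereal_sup_ubound; exists (fun x => t^-1 * f x)%R; last by [].
  split.
    exact: in_spaceZ.
  rewrite (bfnZ (bfs_normP X))// Xft -EFinM gtr0_norm ?invr_gt0//.
  by rewrite mulVf// gt_eqF.
rewrite Xft; apply: le_trans (lee_wpmul2l _ le1); last by rewrite lee_fin ltW.
rewrite -ge0_integralZl; first last.
- by rewrite lee_fin ltW.
- by move=> x _; rewrite lee_fin.
- exact: mfE.
- exact: measurableT.
apply: (ge0_le_integral lebesgue measurableT _ (mfE 1%R)) => [x _||x _].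
- by rewrite lee_fin.
- apply: emeasurable_funM (mfE _); exact: measurable_cst.
rewrite -EFinM lee_fin -[X in (X * `|_|)%R](gtr0_norm t0) -normrM.
by rewrite !mulrA divff ?gt_eqF// mul1r.
Qed.

End banach_function_spaces.

(** * Approximation of 1/K *)

Section fourier_approximation.
Context {R : realType}.
Local Open Scope ring_scope.
Local Open Scope complex_scope.
Local Notation C := (R[i] : numFieldType).

Lemma cvg_Re (u : nat -> C) (l : C) :
  u @ \oo --> l -> (fun k => complex.Re (u k)) @ \oo --> complex.Re l.
Proof.
move=> /cvgrPdist_lt ul; apply/cvgrPdist_lt => e e0.
have := ul e%:C; rewrite ltcR => /(_ e0); apply: filterS => k.
rewrite -(raddfB (@complex.Re R : Rcomplex R -> R)) -ltcR.
exact: le_lt_trans (normc_ge_Re _).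
Qed.

Lemma Re_sum (I : Type) (s : seq I) (z : I -> C) :
  complex.Re (\sum_(i <- s) z i) = \sum_(i <- s) complex.Re (z i).
Proof. exact: (raddf_sum (@complex.Re R : Rcomplex R -> R)). Qed.

Lemma le_norm_Re_Im (z : C) :
  `|complex.Re z| + `|complex.Im z| <= 2 * complex.Re `|z|.
Proof.
rewrite normc_def/= mulr2n mulrDl !mul1r.
by apply: lerD; rewrite -sqrtr_sqr ler_sqrt ?addr_ge0 ?sqr_ge0//
  ?lerDl ?lerDr sqr_ge0.
Qed.

(** Real part of a partial sum of the Fourier series, with [p j] the real part of the coefficient
    [a j] and [q j] minus its imaginary part. *)
Definition trig_poly m (p q : nat -> R) (nu : nat -> 'rV[R]_m) N u :=
  \sum_(0 <= j < N) (p j * cos (dotp (nu j) u) + q j * sin (dotp (nu j) u)).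

Lemma continuous_dotp m (v : 'rV[R]_m) : continuous (dotp v).
Proof.
apply: (@continuous_big _ _ _ _ _ add_continuous) => i _ u.
by apply: continuousM; [exact: cst_continuous|exact: coord_continuous].
Qed.

Lemma continuous_trig_poly m p q (nu : nat -> 'rV[R]_m) N :
  continuous (trig_poly p q nu N).
Proof.
apply: (@continuous_big _ _ _ _ _ add_continuous) => j _ u.
have cvg_trig (a : R) (h : R -> R) : continuous h ->
    (fun x => a * h (dotp (nu j) x)) @ u --> a * h (dotp (nu j) u).
  move=> ch; apply: (@continuousM _ _ (fun=> a) (h \o dotp (nu j))).
    exact: cst_continuous.
  by apply: continuous_comp; [exact: continuous_dotp|exact: ch].
exact: cvgD (cvg_trig _ _ (@continuous_cos R)) (cvg_trig _ _ (@continuous_sin R)).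
Qed.

(** [1 / K] is real, so it is the pointwise limit of the real parts of the partial sums. The tails
    of the coefficient series bound those of these sums independently of [u], so the limit is
    uniform on [B]. *)
Lemma inv_abs_fourier_trig_poly m (K : 'rV[R]_m -> R) B :
  inv_abs_fourier K B ->
  exists (S : R) (p q : nat -> R) (nu : nat -> 'rV[R]_m),
    (forall N, \sum_(0 <= j < N) (`|p j| + `|q j|) <= S) /\
    forall e : R, 0 < e -> exists N, forall u, B u ->
      `|(K u)^-1 - trig_poly p q nu N u| <= e.
Proof.
move=> [_ [a [nu [/cvg_ex[/= l al] aK]]]].
pose p j := complex.Re (a j); pose q j := - complex.Im (a j).
pose c j : R := `|p j| + `|q j|.
pose t N : R := \sum_(0 <= j < N) c j.
have c0 j : 0 <= c j by rewrite addr_ge0.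
have tS M N : (M <= N)%N -> t N = t M + \sum_(M <= j < N) c j.
  by move=> MN; rewrite /t (big_cat_nat (leq0n M) MN).
have ndt : nondecreasing_seq t.
  by move=> M N MN; rewrite (tS _ _ MN) lerDl sumr_ge0.
pose s N := complex.Re (\sum_(0 <= j < N) `|a j|).
have scvg : s @ \oo --> complex.Re l by exact: cvg_Re al.
have nds : nondecreasing_seq s.
  move=> M N MN; rewrite /s !Re_sum [leRHS](big_cat_nat (leq0n M) MN)/= lerDl.
  apply: sumr_ge0 => j _.
  by case: (a j) => x y; exact: sqrtr_ge0.
have cvgt : cvgn t.
  apply: nondecreasing_is_cvgn => //.
  exists (2 * complex.Re l) => _ [N _ <-].
  apply: (@le_trans _ _ (2 * s N)).
    rewrite /s Re_sum mulr_sumr; apply: ler_sum => j _.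
    by rewrite /c /q normrN; exact: le_norm_Re_Im.
  rewrite ler_pM2l// -(cvg_lim (@Rhausdorff R) scvg).
  by apply: nondecreasing_cvgn_le => //; apply/cvg_ex; eexists; exact: scvg.
have ub N : t N <= limn t by exact: nondecreasing_cvgn_le.
exists (limn t), p, q, nu; split => // e e0.
have [N tN] : exists N, limn t - t N < e.
  have /cvgrPdist_lt/(_ _ e0)[N _ /(_ N (leqnn N))] := cvgt.
  by move=> /(le_lt_trans (ler_norm _)) tN; exists N.
(* The index [M] reached for the slack [e'] may depend on [u], but the sum between [N] and [M] is at
   most [e] for every [u]. *)
exists N => u Bu; apply/ler_addgt0Pr => e' e'0.
have Pcvg : (fun M => trig_poly p q nu M u) @ \oo --> (K u)^-1.
  rewrite (_ : (fun M => _) = fun M => complex.Re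
      (series (fun j => a j * expi (dotp (nu j) u)) M)).
    exact: (cvg_Re (aK u Bu)).
  apply/funext => M; rewrite /series/= Re_sum; apply: eq_bigr => j _.
  by rewrite /expi/p/q; case: (a j) => x y /=; rewrite mulNr.
have /cvgrPdist_lt/(_ _ e'0)[M0 _ M0P] := Pcvg.
pose M := maxn M0 N.
have /ltW KM := M0P M (leq_maxl _ _).
rewrite -[_ - _](subrKA (trig_poly p q nu M u)) addrC.
apply: le_trans (ler_normD _ _) _; apply: lerD => //.
apply: le_trans (ltW tN); apply: (@le_trans _ _ (t M - t N)); last first.
  by rewrite lerD2r.
rewrite (tS N M) ?leq_maxr// [leRHS]addrC addKr.
rewrite /trig_poly (big_cat_nat (leq0n N) (leq_maxr M0 N))//=.
rewrite [X in `|X|]addrC addKr.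
apply: le_trans (ler_norm_sum _ _ _) _; apply: ler_sum => j _.
apply: le_trans (ler_normD _ _) _; rewrite !normrM.
by apply: lerD; rewrite ler_piMr// ler_norml ?cos_geN1 ?cos_le1 ?sin_geN1 ?sin_le1.
Qed.

Lemma continuous_sqr_dist m (c : 'rV[R]_m) :
  continuous (fun u : 'rV[R]_m => \sum_i (u ord0 i - c ord0 i) ^+ 2).
Proof.
apply: (@continuous_big _ _ _ _ _ add_continuous) => i _ u.
have cu : (fun x : 'rV[R]_m => x ord0 i - c ord0 i) @ u --> u ord0 i - c ord0 i.
  exact: cvgB (@coord_continuous _ _ _ ord0 i u) (cvg_cst _).
exact: (cvgM cu cu).
Qed.

Lemma near_sup_cube m (c : 'rV[R]_m) (P : set 'rV[R]_m) : nbhs c P ->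
  exists2 d : R, 0 < d &
    forall u : 'rV[R]_m, (forall i, `|u ord0 i - c ord0 i| <= d) -> P u.
Proof.
move=> /nbhs_ballP[e /= e0 ceP]; exists (e / 2); first by rewrite divr_gt0.
move=> u ud; apply: ceP; split => // i j; rewrite /ball/= (ord1 i) distrC.
by apply: le_lt_trans (ud j) _; rewrite gtr_pMr// invf_lt1// ltr1n.
Qed.

(* [1 / K], a uniform limit of continuous functions, is continuous at the
   centre; hence [K] is bounded nearby and the error of the partial sums stays
   small after multiplication by [K]. *)
Lemma inv_abs_fourier_approx m (K : 'rV[R]_m -> R) c (rho : R) : (0 < m)%N ->
  0 < rho -> inv_abs_fourier K (euclidean_ball c rho) ->
  exists (S : R) (p q : nat -> R) (nu : nat -> 'rV[R]_m) (c' : 'rV[R]_m) (d : R),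
    [/\ forall N, \sum_(0 <= j < N) (`|p j| + `|q j|) <= S,
      0 < d, exists i, d < `|c' ord0 i| &
      forall e : R, 0 < e -> exists N, forall u : 'rV[R]_m,
        (forall i, `|u ord0 i - c' ord0 i| <= d) ->
        `|1 - K u * trig_poly p q nu N u| <= e].
Proof.
move=> m0 rho0 Kc; pose i0 := Ordinal m0.
(* The centre must have a nonzero coordinate: if [c = 0], a move by [rho / 2] along the first axis
   stays in the ball. *)
have [c' [i c'0] Bc'] : exists2 c' : 'rV[R]_m,
    exists i, 0 < `|c' ord0 i| & euclidean_ball c rho c'.
  have [c0|/matrix0Pn[j [i c0]]] := eqVneq c 0; last first.
    exists c; first by exists i; move: c0; rewrite (ord1 j) normr_gt0.
    rewrite /euclidean_ball/= big1 ?sqrtr0// => k _.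
    by rewrite subrr expr0n.
  exists (rho / 2 *: delta_mx 0 i0).
    by exists i0; rewrite !mxE !eqxx mulr1 normr_gt0 gt_eqF// divr_gt0.
  rewrite /euclidean_ball/= (bigD1 i0)//= big1 => [|k ki0]; last first.
    by rewrite c0 !mxE (negPf ki0) andbF mulr0 subrr expr0n.
  rewrite c0 !mxE !eqxx mulr1 subr0 addr0 sqrtr_sqr ger0_norm ?divr_ge0 ?ltW//.
  by rewrite gtr_pMr// invf_lt1// ltr1n.
have nB : \forall u \near c', euclidean_ball c rho u.
  have cd : (fun u : 'rV[R]_m => Num.sqrt (\sum_i (u ord0 i - c ord0 i) ^+ 2))
      @ c' --> Num.sqrt (\sum_i (c' ord0 i - c ord0 i) ^+ 2).
    by apply: continuous_comp; [exact: continuous_sqr_dist|exact: sqrt_continuous].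
  exact: cvgr_lt cd _ Bc'.
have [S [p [q [nu [Spq KP]]]]] := inv_abs_fourier_trig_poly Kc.
have K0 : 0 < `|(K c')^-1| by rewrite normr_gt0 invr_eq0; exact: Kc.1.
(* Three errors of size [eta] separate [1 / K] at [c'] from [1 / K] at [u]: the approximation errors
   at both points and the variation of the polynomial. A quarter leaves at least [eta] for the
   modulus of [1 / K] at [u]. *)
pose eta := `|(K c')^-1| / 4.
have eta0 : 0 < eta by rewrite divr_gt0.
have [N KN] := KP _ eta0.
have nP : \forall u \near c',
    `|trig_poly p q nu N c' - trig_poly p q nu N u| < eta.
  have := @continuous_trig_poly _ p q nu N c'.
  by move=> /cvgrPdist_lt/(_ _ eta0).
have [d d0 dP] := near_sup_cube (filterI nB nP).
(* The cap on the radius makes it strictly smaller than the modulus of the nonzero coordinate, so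
   the closed cube misses the origin. *)
exists S, p, q, nu, c', (Num.min d (`|c' ord0 i| / 2)); split => //.
- by rewrite lt_min d0 divr_gt0.
- exists i; rewrite gt_min; apply/orP; right.
  by rewrite gtr_pMr// invf_lt1// ltr1n.
move=> e e0.
(* Multiplying by [K u], of modulus at most [1 / eta], turns this precision into [e]. *)
have [M KM] := KP (e * eta) (mulr_gt0 e0 eta0).
exists M => u ud; have /dP[Bu Pu] i' : `|u ord0 i' - c' ord0 i'| <= d.
  by apply: le_trans (ud i') _; rewrite ge_min lexx.
have Ku : eta <= `|(K u)^-1|.
  rewrite -(lerD2r (3 * eta)).
  have -> : eta + 3 * eta = `|(K c')^-1| by rewrite /eta; lra.
  rewrite -[X in `|X|](subrK (trig_poly p q nu N c')).
  rewrite -[X in _ + X](subrK (trig_poly p q nu N u)).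
  rewrite -[X in _ + (_ + X)](subrK ((K u)^-1)).
  apply: le_trans (ler_normD _ _) _.
  have h1 := KN _ Bc'.
  apply: le_trans (lerD h1 (ler_normD _ _)) _.
  apply: le_trans (lerD (lexx _) (lerD (ltW Pu) (ler_normD _ _))) _.
  have := KN _ Bu; rewrite distrC => h2.
  by apply: le_trans (lerD (lexx _) (lerD (lexx _) (lerD h2 (lexx _)))) _; lra.
have Kun0 : K u != 0 by exact: Kc.1.
rewrite -[X in X - _](mulfV Kun0) -mulrBr normrM.
apply: le_trans (ler_wpM2l (normr_ge0 _) (KM _ Bu)) _.
rewrite mulrCA -[leRHS]mulr1 ler_pM2l// mulrC -ler_pdivlMr ?normr_gt0// mul1r.
by rewrite -normfV.
Qed.

End fourier_approximation.

(** * Iterated integrals *)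

Section iterated_integrals.
Context {d : measure_display} {T : measurableType d} {R : realType}.
Variable mu : {measure set T -> \bar R}.
Implicit Types (F G : T -> T -> R) (v w : R) (h : T -> R).

(* The inner integral is only required to agree a.e. with an integrable [h]:
   this makes the notion stable under sums without completeness of [mu]. *)
Definition has_iint F v : Prop := exists h,
  [/\ {ae mu, forall z, mu.-integrable setT (fun y => (F y z)%:E) /\
        h z = (\int[mu]_y F y z)%R},
      mu.-integrable setT (EFin \o h) &
      v = (\int[mu]_z h z)%R].

Lemma has_iintZ c F v : has_iint F v ->
  has_iint (fun y z => c * F y z)%R (c * v)%R.
Proof.
move=> [h [Fh ih ->]]; exists (fun z => c * h z)%R; split.
- apply: filterS Fh => z [iF ->]; split; last by rewrite RintegralZl.
  exact: (integrableZl measurableT c iF).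
- exact: (integrableZl measurableT c ih).
- by rewrite RintegralZl.
Qed.

Lemma has_iintD F G v w : has_iint F v -> has_iint G w ->
  has_iint (fun y z => F y z + G y z)%R (v + w)%R.
Proof.
move=> [h [Fh ih ->]] [k [Gk ik ->]]; exists (fun z => h z + k z)%R; split.
- apply: filterS2 Fh Gk => z [iF ->] [iG ->].
  by split; [exact: (integrableD measurableT iF iG)|rewrite RintegralD].
- exact: (integrableD measurableT ih ik).
- by rewrite RintegralD.
Qed.

Lemma has_iintB F G v w : has_iint F v -> has_iint G w ->
  has_iint (fun y z => F y z - G y z)%R (v - w)%R.
Proof.
move=> Fv /(has_iintZ (-1)%R) Gw; rewrite -mulN1r.
by under eq_fun do under eq_fun do rewrite -mulN1r; exact: has_iintD.
Qed.

Lemma has_iint0 : has_iint (fun _ _ => 0%R) 0%R.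
Proof.
have i0 : mu.-integrable setT (EFin \o (fun=> 0%R)) by exact: integrable0.
exists (fun=> 0%R); split => //; last by rewrite Rintegral_cst ?mul0r.
by apply: aeW => z; split => //; rewrite Rintegral_cst ?mul0r.
Qed.

Lemma has_iint_sum (I : Type) (s : seq I) (F : I -> T -> T -> R) (v : I -> R) :
  (forall i, has_iint (F i) (v i)) ->
  has_iint (fun y z => \sum_(i <- s) F i y z)%R (\sum_(i <- s) v i)%R.
Proof.
move=> Fv; elim: s => [|i s IHs].
  rewrite big_nil; under eq_fun do under eq_fun do rewrite big_nil.
  exact: has_iint0.
rewrite big_cons; under eq_fun do under eq_fun do rewrite big_cons.
exact: has_iintD.
Qed.

Lemma has_iintM (f g : T -> R) : mu.-integrable setT (EFin \o f) ->
  mu.-integrable setT (EFin \o g) ->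
  has_iint (fun y z => f y * g z)%R (\int[mu]_y f y * \int[mu]_z g z)%R.
Proof.
move=> fi gi; exists (fun z => \int[mu]_y f y * g z)%R; split.
- apply: aeW => z; split; last by rewrite RintegralZr.
  exact: (integrableZr measurableT (g z) fi).
- exact: (integrableZl measurableT _ gi).
- by rewrite RintegralZl.
Qed.

(** Monotonicity of the integral in [y] for almost every [z], then in [z]. This carries the
    pointwise error of the approximation over to the iterated integrals. *)
Lemma le_norm_has_iint F G v w : has_iint F v -> has_iint G w ->
  (forall y z, `|F y z| <= G y z)%R -> (`|v| <= w)%R.
Proof.
move=> [h [Fh ih ->]] [k [Gk ik ->]] FG.
apply: le_trans (le_normr_Rintegral _ ih) _ => //.
have hk : {ae mu, forall z, `|h z| <= k z}%R.
  apply: filterS2 Fh Gk => z [iF ->] [iG ->].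
  apply: le_trans (le_normr_Rintegral _ iF) _ => //.
  apply: le_Rintegral => //; exact: integrable_norm.
have mh : measurable_fun setT h by apply/measurable_EFinP; exact: measurable_int ih.
have mk : measurable_fun setT k by apply/measurable_EFinP; exact: measurable_int ik.
(* [k] is known to be nonnegative only a.e., whereas the comparison below takes integrands that are
   nonnegative everywhere. *)
have -> : (\int[mu]_z k z = \int[mu]_z `|k z|)%R.
  rewrite /Rintegral; congr fine; apply: ae_eq_integral => //.
  - exact: measurable_int ik.
  - exact: measurable_EFin_norm.
  - by apply: filterS hk => z hkz _; rewrite ger0_norm// (le_trans _ hkz).
apply: fine_le.
- apply: integrable_fin_num => //; exact: (integrable_norm ih).
- apply: integrable_fin_num => //; exact: (integrable_norm ik).
apply: ae_ge0_le_integral => //; try exact: measurable_EFin_norm.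
by apply: filterS hk => z hkz _; rewrite lee_fin (le_trans hkz)// ler_norm.
Qed.

End iterated_integrals.

(** * Separation of variables *)

Section separation_of_variables.
Context {R : realType}.
Local Open Scope ring_scope.

Definition trig (e : bool) (t : R) := if e then sin t else cos t.

(** Coefficients of the four products of a sine or cosine of [B] with one of [C] in the addition
    formulas for the angle [A - (B + C)]. The phase [A], which will depend on [x], enters only
    here. *)
Definition trig_coef (p q A : R) (e : bool * bool) :=
  match e with
  | (false, false) => p * cos A + q * sin A
  | (true, true) => - (p * cos A + q * sin A)
  | _ => p * sin A - q * cos A
  end.

Lemma trig_separation p q A B C :
  p * cos (A - (B + C)) + q * sin (A - (B + C)) =
  \sum_(e : bool * bool) trig_coef p q A e * (trig e.1 B * trig e.2 C).
Proof.
rewrite (eq_bigr (fun e => trig_coef p q A (e.1, e.2) *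
  (trig e.1 B * trig e.2 C))) => [|[]//].
rewrite -(pair_bigA _ (fun e1 e2 =>
  trig_coef p q A (e1, e2) * (trig e1 B * trig e2 C)))/= !big_bool/=.
rewrite cosB sinB cosD sinD; ring.
Qed.

Lemma norm_cos_le1 (t : R) : `|cos t| <= 1.
Proof. by rewrite ler_norml cos_geN1 cos_le1. Qed.

Lemma norm_sin_le1 (t : R) : `|sin t| <= 1.
Proof. by rewrite ler_norml sin_geN1 sin_le1. Qed.

Lemma norm_trig_le1 e t : `|trig e t| <= 1.
Proof. by case: e; rewrite /= ?norm_sin_le1 ?norm_cos_le1. Qed.

Lemma norm_trig_coef_le p q A e : `|trig_coef p q A e| <= `|p| + `|q|.
Proof.
have le2 (x y : R) : `|x| <= 1 -> `|y| <= 1 -> `|p * x + q * y| <= `|p| + `|q|.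
  move=> x1 y1; apply: le_trans (ler_normD _ _) _; rewrite !normrM.
  by apply: lerD; rewrite ler_piMr.
case: e => [[] []] /=; rewrite ?normrN; try apply: le2;
  rewrite ?norm_sin_le1 ?norm_cos_le1//.
- by rewrite -mulrN; apply: le2; rewrite ?normrN ?norm_sin_le1 ?norm_cos_le1.
- by rewrite -mulrN; apply: le2; rewrite ?normrN ?norm_sin_le1 ?norm_cos_le1.
Qed.

Lemma dotpBr n (v x y : 'rV[R]_n) : dotp v (x - y) = dotp v x - dotp v y.
Proof.
by rewrite /dotp -sumrB; apply: eq_bigr => i _; rewrite !mxE mulrBr.
Qed.

Lemma dotp_row_mx n (v : 'rV[R]_(n + n)) (t : R) (x y : 'rV[R]_n) :
  dotp v (t *: row_mx x y) = t * dotp (lsubmx v) x + t * dotp (rsubmx v) y.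
Proof.
rewrite /dotp big_split_ord !mulr_sumr; congr (_ + _); apply: eq_bigr => i _.
  by rewrite [X in _ * X]mxE row_mxEl [in RHS]mxE mulrCA.
by rewrite [X in _ * X]mxE row_mxEr [in RHS]mxE mulrCA.
Qed.

(** Each frequency splits into two halves, so the angle is a term in [x] minus a term in [y] and a
    term in [z]; the addition formulas then separate the variables. *)
Lemma trig_poly_separation n p q (nu : nat -> 'rV[R]_(n + n)) N t x y z :
  trig_poly p q nu N (t *: row_mx (x - y) (x - z)) =
  \sum_(0 <= j < N) \sum_(e : bool * bool)
    trig_coef (p j) (q j)
      (t * dotp (lsubmx (nu j)) x + t * dotp (rsubmx (nu j)) x) e *
    (trig e.1 (t * dotp (lsubmx (nu j)) y) *
     trig e.2 (t * dotp (rsubmx (nu j)) z)).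
Proof.
apply: eq_bigr => j _; rewrite -trig_separation dotp_row_mx !dotpBr !mulrBr.
by rewrite opprD addrACA.
Qed.

Lemma measurable_trig_dotp n e t (v : 'rV[R]_n) :
  measurable_fun setT (fun x => trig e (t * dotp v x)).
Proof.
apply: (@measurableT_comp _ _ _ _ _ _ (trig e)).
  by apply: continuous_measurable_fun; case: e;
    [exact: continuous_sin|exact: continuous_cos].
by apply: measurable_funM; [exact: measurable_cst|exact: measurable_dotp].
Qed.

(** The modulated characteristic functions on which the commutator is tested. Being dominated by
    [\1_E], they lie in every Banach function space when [E] is bounded and measurable. *)
Definition trig_test n e t (v : 'rV[R]_n) E x := trig e (t * dotp v x) * \1_E x.

Lemma measurable_trig_test n e t (v : 'rV[R]_n) E : measurable E ->
  measurable_fun setT (trig_test e t v E).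
Proof.
move=> mE; apply: measurable_funM; first exact: measurable_trig_dotp.
exact: measurable_indic.
Qed.

Lemma norm_trig_test_le n e t (v : 'rV[R]_n) E x :
  `|trig_test e t v E x| <= \1_E x.
Proof.
by rewrite normrM [X in _ * X]ger0_norm// ler_piMl// norm_trig_le1.
Qed.

End separation_of_variables.

(** * Supports and the integral representation of the commutators *)

Section supports.
Context {R : realType} {n : nat}.
Implicit Types (f g b : 'rV[R]_n -> R) (E : set 'rV[R]_n).

Lemma supp_subset f E : closed E -> (forall x, ~ E x -> f x = 0%R) -> supp f `<=` E.
Proof.
move=> cE f0; rewrite [X in _ `<=` X](closure_id E).1//.
by apply: closure_subset => x /= /eqP fx; apply: contrapT => /f0.
Qed.

Lemma suppM_subset b f : supp (fun x => b x * f x)%R `<=` supp f.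
Proof.
by apply: closure_subset => x /=; rewrite mulf_eq0 negb_or => /andP[].
Qed.

Lemma represented_has_iint (K : 'rV[R]_(n + n) -> R) T f g x :
  represented_by K T f g -> ~ (supp f `&` supp g) x ->
  has_iint lebesgue
    (fun y z => K (row_mx (x - y) (x - z)) * f y * g z)%R (T f g x).
Proof.
move=> KT /KT[Fy Fz ->].
exists (fun z => \int[lebesgue]_y
  (K (row_mx (x - y) (x - z)) * f y * g z))%R; split => //.
by apply: filterS Fy.
Qed.

Definition commutator (side : bool) b T :=
  if side then commutator1 b T else commutator2 b T.

(** Difference of two representations: [b x] times that of [T f g], and the one with [b] moved
    inside. A factor [b] does not enlarge the support, so both hold at the same [x]. *)
Lemma commutator_has_iint side (K : 'rV[R]_(n + n) -> R) b T f g x :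
  represented_by K T f g ->
  (if side then represented_by K T (fun y => b y * f y)%R g
   else represented_by K T f (fun z => b z * g z)%R) ->
  ~ (supp f `&` supp g) x ->
  has_iint lebesgue (fun y z => (b x - b (if side then y else z)) *
    (K (row_mx (x - y) (x - z)) * f y * g z))%R (commutator side b T f g x).
Proof.
move=> KT bKT xfg.
have /(has_iintZ (b x)) Kfg := represented_has_iint KT xfg.
case: side bKT => bKT.
  have /(represented_has_iint bKT) : ~ (supp (fun y => b y * f y)%R `&` supp g) x.
    by apply: contra_not xfg => -[/suppM_subset].
  move/(has_iintB Kfg); congr has_iint.
  by apply/funext => y; apply/funext => z; ring.
have /(represented_has_iint bKT) : ~ (supp f `&` supp (fun z => b z * g z)%R) x.
  by apply: contra_not xfg => -[? /suppM_subset].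
move/(has_iintB Kfg); congr has_iint.
by apply/funext => y; apply/funext => z; ring.
Qed.

End supports.

(** * Oscillation of b on a cube *)

Section products_of_indicators.
Context {d : measure_display} {T : measurableType d} {R : realType}.
Variable mu : {measure set T -> \bar R}.
Implicit Types (E : set T) (w : R) (f : T -> R).

Lemma integrable_indic_fin E w : measurable E -> mu E = w%:E ->
  mu.-integrable setT (EFin \o \1_E).
Proof.
move=> mE Ew; apply/integrableP; split.
  by apply/measurable_EFinP; exact: measurable_indic.
under eq_integral do rewrite /= ger0_norm//.
by rewrite integral_indic// setIT Ew ltry.
Qed.

Lemma Rintegral_indic E w : measurable E -> mu E = w%:E ->
  (\int[mu]_x \1_E x)%R = w.
Proof. by move=> mE Ew; rewrite /Rintegral integral_indic// setIT Ew. Qed.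

(** Meant for two choices: [c = b x] with [f = - b] gives the main term, and the absolute values of
    [b x] and [b] give the error term. *)
Lemma has_iint_indic (side : bool) c f E1 E2 w :
  measurable E1 -> measurable E2 -> mu E1 = w%:E -> mu E2 = w%:E ->
  mu.-integrable setT
    (EFin \o (fun y => f y * \1_(if side then E1 else E2) y)%R) ->
  has_iint mu
    (fun y z => (c + f (if side then y else z)) * (\1_E1 y * \1_E2 z))%R
    ((c * w + \int[mu]_y (f y * \1_(if side then E1 else E2) y)) * w)%R.
Proof.
move=> mE1 mE2 w1 w2.
have i1 := integrable_indic_fin mE1 w1; have i2 := integrable_indic_fin mE2 w2.
have /(has_iintZ c) := has_iintM i1 i2.
rewrite (Rintegral_indic mE1 w1) (Rintegral_indic mE2 w2) => cw.
case: side => fi.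
  have := has_iintM fi i2; rewrite (Rintegral_indic mE2 w2) => /(has_iintD cw).
  rewrite mulrA -mulrDl; congr has_iint.
  by apply/funext => y; apply/funext => z; ring.
have := has_iintM i1 fi; rewrite (Rintegral_indic mE1 w1) => /(has_iintD cw).
rewrite mulrA [X in (_ + X)%R]mulrC -mulrDl; congr has_iint.
by apply/funext => y; apply/funext => z; ring.
Qed.

Lemma integral_indicM E f : measurable E ->
  \int[mu]_x `|f x * \1_E x|%:E = \int[mu]_(x in E) `|f x|%:E.
Proof.
move=> mE; rewrite [RHS]integral_mkcond; apply: eq_integral => x _.
rewrite patchE indicE; case: ifPn => _; first by rewrite mulr1.
by rewrite mulr0 normr0.
Qed.

Lemma integrable_indicM E f : measurable E -> measurable_fun setT f ->
  \int[mu]_(x in E) `|f x|%:E < +oo ->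
  mu.-integrable setT (EFin \o (fun x => f x * \1_E x)%R).
Proof.
move=> mE mf fE; apply/integrableP; split.
  by apply/measurable_EFinP; apply: measurable_funM => //; exact: measurable_indic.
by under eq_integral do rewrite /=; rewrite integral_indicM.
Qed.

End products_of_indicators.

Section oscillation.
Context {R : realType} {n : nat}.
Variables (side : bool) (K : 'rV[R]_(n + n) -> R) (b : 'rV[R]_n -> R).
Variables (E1 E2 : set 'rV[R]_n) (w t M : R).
Variables (p q : nat -> R) (nu : nat -> 'rV[R]_(n + n)).
Hypotheses (mE1 : measurable E1) (mE2 : measurable E2).
Hypotheses (E1w : lebesgue E1 = w%:E) (E2w : lebesgue E2 = w%:E).
Hypotheses (w0 : (0 < w)%R) (M0 : (0 < M)%R).
Hypothesis b12 : lebesgue.-integrable setT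
  (EFin \o (fun y => b y * \1_(if side then E1 else E2) y)%R).

Let mean := (w^-1 * \int[lebesgue]_y (b y * \1_(if side then E1 else E2) y))%R.
Let absint := (\int[lebesgue]_y (`|b y| * \1_(if side then E1 else E2) y))%R.
Let phi j (e : bool * bool) := trig_test e.1 t (lsubmx (nu j)) E1.
Let psi j (e : bool * bool) := trig_test e.2 t (rsubmx (nu j)) E2.

(** [M] is within [eps] of [K] times the trigonometric polynomial. Multiplying by [b x - b s], where
    [s] is [y] or [z] according to [side], and integrating over [E1] and [E2] turns [M] into the
    left-hand side, the polynomial into values of [D], and [eps] into the last term. *)
Lemma pointwise_oscillation_le N (eps : R) x
    (D : ('rV[R]_n -> R) -> ('rV[R]_n -> R) -> R) :
  (forall j e, has_iint lebesgue
     (fun y z => (b x - b (if side then y else z)) *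
       (K (row_mx (x - y) (x - z)) * phi j e y * psi j e z))%R
     (D (phi j e) (psi j e))) ->
  (forall y z, E1 y -> E2 z -> `|M - K (row_mx (x - y) (x - z)) *
     trig_poly p q nu N (t *: row_mx (x - y) (x - z))| <= eps)%R ->
  (M * w ^+ 2 * `|b x - mean| <=
   \sum_(0 <= j < N) \sum_(e : bool * bool)
     (`|p j| + `|q j|) * `|D (phi j e) (psi j e)| +
   eps * ((`|b x| * w + absint) * w))%R.
Proof.
move=> HD HK; pose coef j e := trig_coef (p j) (q j)
  (t * dotp (lsubmx (nu j)) x + t * dotp (rsubmx (nu j)) x)%R e.
have bN : lebesgue.-integrable setT
    (EFin \o (fun y => - b y * \1_(if side then E1 else E2) y)%R).
  have := integrableZl measurableT (-1)%R b12; congr (_.-integrable _ _).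
  by apply/funext => y /=; rewrite -EFinM mulrA mulN1r.
have ba : lebesgue.-integrable setT
    (EFin \o (fun y => `|b y| * \1_(if side then E1 else E2) y)%R).
  have := integrable_norm b12; congr (_.-integrable _ _).
  by apply/funext => y /=; rewrite normrM [X in (_ * X)%:E]ger0_norm.
have H1 := has_iintZ M (has_iint_indic (b x) mE1 mE2 E1w E2w bN).
have H2 := has_iint_sum (index_iota 0 N) (fun j =>
  has_iint_sum (index_enum (bool * bool)%type) (fun e =>
    has_iintZ (coef j e) (HD j e))).
have H3 := has_iintZ eps (has_iint_indic `|b x| mE1 mE2 E1w E2w ba).
have := le_norm_has_iint (has_iintB H1 H2) H3.
have -> : (\int[lebesgue]_y (- b y * \1_(if side then E1 else E2) y) =
    - (w * mean))%R.
  rewrite /mean mulrA divff ?gt_eqF// mul1r -mulN1r -RintegralZl//.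
  by apply: eq_Rintegral => y _; rewrite mulrA mulN1r.
move=> le_bound.
have -> : (M * w ^+ 2 * `|b x - mean| =
    `|M * ((b x * w + - (w * mean)) * w)|)%R.
  rewrite -[in LHS](gtr0_norm (mulr_gt0 M0 (exprn_gt0 2 w0))) -normrM.
  by congr (`|_|)%R; ring.
rewrite -lerBlDl.
set A := (M * _)%R in le_bound *; set S := (\sum_(i <- _) _)%R in le_bound.
apply: (@le_trans _ _ (`|A| - `|S|)%R).
  apply: lerB => //; apply: le_trans (ler_norm_sum _ _ _) _.
  apply: ler_sum => j _; apply: le_trans (ler_norm_sum _ _ _) _.
  apply: ler_sum => e _; rewrite normrM ler_wpM2r//; exact: norm_trig_coef_le.
apply: le_trans (lerB_dist _ _) _; apply: le_bound => y z.
set s := if side then y else z.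
(* Separation of variables read backwards: the test functions recombine into the trigonometric
   polynomial restricted to [E1] and [E2]. *)
have -> : (\sum_(0 <= j < N) \sum_(e : bool * bool) coef j e * ((b x - b s) *
      (K (row_mx (x - y) (x - z)) * phi j e y * psi j e z)) =
    (b x - b s) * (\1_E1 y * \1_E2 z) * (K (row_mx (x - y) (x - z)) *
      trig_poly p q nu N (t *: row_mx (x - y) (x - z))))%R.
  rewrite trig_poly_separation 2!mulr_sumr; apply: eq_bigr => j _.
  rewrite 2!mulr_sumr; apply: eq_bigr => e _.
  by rewrite /coef /phi /psi /trig_test; ring.
have -> k : (M * ((b x + - b s) * (\1_E1 y * \1_E2 z)) -
    (b x - b s) * (\1_E1 y * \1_E2 z) * k =
    (b x - b s) * (\1_E1 y * \1_E2 z) * (M - k))%R by ring.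
rewrite !indicE.
have [/set_mem yE1|_] := boolP (y \in E1); last by rewrite !(mul0r, mulr0) normr0.
have [/set_mem zE2|_] := boolP (z \in E2); last by rewrite !(mul0r, mulr0) normr0.
rewrite !mulr1 normrM mulrC; apply: ler_pM => //; first exact: HK.
exact: ler_normB.
Qed.

(** Integrate the pointwise bound over [Q] and let [eps] tend to 0. Although [N] depends on [eps],
    the coefficients sum to at most [S] for every [N], and the factor [H] of [eps] is independent of
    [N]. The 4 counts the trigonometric products per frequency. *)
Lemma oscillation_le Q (S Z : R)
    (D : ('rV[R]_n -> R) -> ('rV[R]_n -> R) -> 'rV[R]_n -> R) :
  measurable Q -> lebesgue Q = w%:E -> measurable_fun setT b ->
  \int[lebesgue]_(x in Q) `|b x|%:E < +oo ->
  (forall N, \sum_(0 <= j < N) (`|p j| + `|q j|) <= S)%R ->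
  (forall j e, [/\ measurable_fun setT (D (phi j e) (psi j e)),
     \int[lebesgue]_(x in Q) `|D (phi j e) (psi j e) x|%:E <= Z%:E &
     forall x, Q x -> has_iint lebesgue
       (fun y z => (b x - b (if side then y else z)) *
         (K (row_mx (x - y) (x - z)) * phi j e y * psi j e z))%R
       (D (phi j e) (psi j e) x)]) ->
  (forall eps : R, (0 < eps)%R -> exists N, forall x y z,
     Q x -> E1 y -> E2 z -> `|M - K (row_mx (x - y) (x - z)) *
       trig_poly p q nu N (t *: row_mx (x - y) (x - z))| <= eps)%R ->
  (M * w ^+ 2)%:E * \int[lebesgue]_(x in Q) `|b x - mean|%:E <= (4 * S * Z)%:E.
Proof.
move=> mQ Qw mb bQ pqS HD HK; have w0' := ltW w0.
have Z0 : (0 <= Z)%R.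
  have [_ + _] := HD 0%N (false, false); rewrite -lee_fin; apply: le_trans.
  by apply: integral_ge0 => x _; rewrite lee_fin.
set B := \int[lebesgue]_(x in Q) `|b x|%:E in bQ.
have B0 : 0 <= B by apply: integral_ge0 => x _; rewrite lee_fin.
have absint0 : (0 <= absint)%R.
  by apply: Rintegral_ge0 => y _; rewrite mulr_ge0.
have mbm (c : R) D' : measurable_fun D' (fun x => `|b x - c|%:E).
  apply: measurable_funTS; apply: measurable_EFin_norm.
  by apply: measurable_funB => //; exact: measurable_cst.
pose H := ((fine B * w + absint * w) * w)%R.
have H0 : (0 <= H)%R.
  exact: mulr_ge0 (addr_ge0 (mulr_ge0 (fine_ge0 B0) w0')
    (mulr_ge0 absint0 w0')) w0'.
have main (eps : R) : (0 < eps)%R ->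
    (M * w ^+ 2)%:E * \int[lebesgue]_(x in Q) `|b x - mean|%:E <=
    (4 * S * Z)%:E + (eps * H)%:E.
  move=> eps0; have [N HN] := HK _ eps0.
  pose F j e x := ((`|p j| + `|q j|) * `|D (phi j e) (psi j e) x|)%R.
  pose G x := (eps * ((`|b x| * w + absint) * w))%R.
  have F0 j e x : (0 <= F j e x)%R by rewrite mulr_ge0 ?addr_ge0.
  have G0 x : (0 <= G x)%R.
    exact: mulr_ge0 (ltW eps0) (mulr_ge0 (addr_ge0 (mulr_ge0 _ w0') absint0) w0').
  have mF j e : measurable_fun Q (fun x => (F j e x)%:E).
    apply: measurable_funTS; apply/measurable_EFinP; apply: measurable_funM.
      exact: measurable_cst.
    by have [mD _ _] := HD j e; exact: measurableT_comp.
  have mG : measurable_fun Q (fun x => (G x)%:E).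
    apply: measurable_funTS; apply/measurable_EFinP.
    apply: measurable_funM; first exact: measurable_cst.
    apply: measurable_funM; last exact: measurable_cst.
    apply: measurable_funD; last exact: measurable_cst.
    apply: measurable_funM; last exact: measurable_cst.
    exact: measurableT_comp.
  have iF j e : \int[lebesgue]_(x in Q) (F j e x)%:E <=
      ((`|p j| + `|q j|) * Z)%:E.
    under eq_integral do rewrite EFinM.
    have [mD DZ _] := HD j e.
    have c0 : 0 <= (`|p j| + `|q j|)%:E by rewrite lee_fin addr_ge0.
    rewrite ge0_integralZl; first by rewrite EFinM; exact: lee_wpmul2l.
    - exact: mQ.
    - by apply: measurable_funTS; exact: measurable_EFin_norm.
    - by move=> x _; rewrite lee_fin.
    - exact: c0.
  have iG : \int[lebesgue]_(x in Q) (G x)%:E = (eps * H)%:E.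
    rewrite (_ : (fun x => (G x)%:E) = (fun x => (eps * w * w)%:E * `|b x|%:E +
        (eps * absint * w)%:E)); last first.
      by apply/funext => x; rewrite -EFinM -EFinD /G; congr EFin; ring.
    have e1 : (0 <= eps * w * w)%R by exact: mulr_ge0 (mulr_ge0 (ltW eps0) w0') w0'.
    have e2 : (0 <= eps * absint * w)%R.
      exact: mulr_ge0 (mulr_ge0 (ltW eps0) absint0) w0'.
    have mbQ : measurable_fun Q (fun x => `|b x|%:E).
      by apply: measurable_funTS; exact: measurable_EFin_norm.
    rewrite ge0_integralD; first last.
    - exact: measurable_cst.
    - by move=> x _; rewrite lee_fin.
    - by apply: emeasurable_funM => //; exact: measurable_cst.
    - by move=> x _; rewrite mule_ge0 ?lee_fin.
    - exact: mQ.
    rewrite ge0_integralZl; first last.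
    - by rewrite lee_fin.
    - by move=> x _; rewrite lee_fin.
    - exact: mbQ.
    - exact: mQ.
    have BE : B = (fine B)%:E by rewrite fineK// ge0_fin_numE.
    rewrite integral_cst// [X in _ + _ * X](_ : _ = w%:E)// -/B BE.
    by rewrite -!EFinM -EFinD /H; congr EFin; ring.
  have Mw0 : (0 <= M * w ^+ 2)%R by rewrite mulr_ge0 ?exprn_ge0 ?ltW.
  rewrite -ge0_integralZl; first last.
  - by rewrite lee_fin.
  - by move=> x _; rewrite lee_fin.
  - exact: mbm.
  - exact: mQ.
  apply: (@le_trans _ _ (\int[lebesgue]_(x in Q)
      ((\sum_(0 <= j < N) \sum_(e : bool * bool) F j e x)%R%:E + (G x)%:E))).
    apply: (ge0_le_integral lebesgue mQ).
    - by move=> x _; rewrite mule_ge0 ?lee_fin.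
    - by apply: emeasurable_funM; [exact: measurable_cst|exact: mbm].
    - apply: emeasurable_funD mG; apply/measurable_EFinP.
      apply: measurable_sum => j; apply: measurable_sum => e.
      by apply/measurable_EFinP; exact: mF.
    - move=> x Qx; rewrite -EFinM -EFinD lee_fin.
      apply: (pointwise_oscillation_le (D := fun f g => D f g x)).
        by move=> j e; have [_ _] := HD j e; exact.
      by move=> y z; exact: HN.
  rewrite ge0_integralD; first last.
  - exact: mG.
  - by move=> x _; rewrite lee_fin.
  - apply/measurable_EFinP.
    apply: measurable_sum => j; apply: measurable_sum => e.
    by apply/measurable_EFinP; exact: mF.
  - by move=> x _; rewrite lee_fin sumr_ge0// => j _; rewrite sumr_ge0.
  - exact: mQ.
  rewrite iG leeD2r//.
  under eq_integral do rewrite -sumEFin.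
  rewrite ge0_integral_sum; first last.
  - by move=> j x _; rewrite lee_fin sumr_ge0.
  - move=> j; under eq_fun do rewrite -sumEFin.
    by apply: emeasurable_sum => e; exact: mF.
  - exact: mQ.
  apply: (@le_trans _ _ (\sum_(0 <= j < N) (4 * ((`|p j| + `|q j|) * Z))%:E)).
    apply: lee_sum => j _; under eq_integral do rewrite -sumEFin.
    rewrite ge0_integral_sum; first last.
    - by move=> e x _; rewrite lee_fin.
    - by move=> e; exact: mF.
    - exact: mQ.
    apply: le_trans (lee_sum _ (fun e _ => iF j e)) _.
    rewrite sumEFin lee_fin sumr_const (_ : #|_| = 4%N) ?mulr_natl//.
    by rewrite card_prod card_bool.
  rewrite sumEFin lee_fin -mulr_sumr -mulr_suml mulrA ler_wpM2r//.
  by rewrite ler_wpM2l.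
apply/lee_addgt0Pr => e e0.
have H10 : (0 < H + 1)%R by rewrite ltr_wpDl.
apply: le_trans (main (e / (H + 1))%R _) _; first by rewrite divr_gt0.
rewrite leeD2l// lee_fin mulrAC -mulrA ler_piMr ?(ltW e0)//.
by rewrite ler_pdivrMr// mul1r lerDl.
Qed.

End oscillation.

(** * Bounded mean oscillation *)

Section bounded_mean_oscillation.
Context {R : realType} {n : nat}.
Implicit Types (b : 'rV[R]_n -> R) (Q : set 'rV[R]_n).

(** The distance from [A] to the average is at most the mean of the modulus of [b - A] over [Q], so
    passing from [A] to the average at most doubles the integral. *)
Lemma average_oscillation_le b Q (w A : R) : measurable Q ->
  lebesgue Q = w%:E -> (0 < w)%R -> measurable_fun setT b ->
  \int[lebesgue]_(x in Q) `|b x|%:E < +oo ->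
  \int[lebesgue]_(x in Q) `|b x - average b Q|%:E <=
  2%:E * \int[lebesgue]_(x in Q) `|b x - A|%:E.
Proof.
move=> mQ Qw w0 mb bQ.
have ib : lebesgue.-integrable Q (EFin \o b).
  apply/integrableP; split; last exact: bQ.
  by apply/measurable_EFinP; exact: measurable_funTS.
have iA : lebesgue.-integrable Q (EFin \o (fun=> A)).
  apply/integrableP; split; first by apply/measurable_EFinP.
  rewrite integral_cst; last exact: mQ.
  by rewrite [X in _ * X](_ : _ = w%:E)// -EFinM ltry.
have ibA : lebesgue.-integrable Q (EFin \o (fun x => b x - A)%R).
  exact: (integrableB mQ ib iA).
have mbA (c : R) : measurable_fun Q (fun x => `|b x - c|%:E).
  apply: measurable_funTS; apply: measurable_EFin_norm.
  by apply: measurable_funB => //; exact: measurable_cst.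
set m := average b Q; set I := \int[lebesgue]_(x in Q) `|b x - A|%:E.
have mw : (`|A - m| * w)%:E <= I.
  have -> : (`|A - m| * w = `|\int[lebesgue]_(x in Q) (b x - A)|)%R.
    rewrite RintegralB// Rintegral_cst// [X in fine X](_ : _ = w%:E)//=.
    have -> : (\int[lebesgue]_(x in Q) b x = m * w)%R.
      by rewrite /m /average /volume Qw/= mulrAC mulVf ?gt_eqF// mul1r.
    by rewrite -mulrBl normrM (gtr0_norm w0) distrC.
  rewrite EFin_normr_Rintegral//.
  by apply: (le_abse_integral lebesgue mQ); case/integrableP: ibA.
apply: (@le_trans _ _ (\int[lebesgue]_(x in Q) (`|b x - A|%:E + `|A - m|%:E))).
  apply: (ge0_le_integral lebesgue mQ).
  - by move=> x _; rewrite lee_fin.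
  - exact: mbA.
  - by apply: emeasurable_funD; [exact: mbA|exact: measurable_cst].
  - by move=> x _; rewrite -EFinD lee_fin -[X in (`|X| <= _)%R](subrKA A) ler_normD.
rewrite ge0_integralD; first last.
- exact: measurable_cst.
- by move=> x _; rewrite lee_fin.
- exact: mbA.
- by move=> x _; rewrite lee_fin.
- exact: mQ.
rewrite integral_cst; last exact: mQ.
rewrite [X in _ + _ * X](_ : _ = w%:E)// -EFinM (_ : 2%:E = 1 + 1)//.
rewrite ge0_muleDl// !mul1e.
exact: leeD2l.
Qed.

Lemma locally_L1_cube b a r : locally_L1 b ->
  \int[lebesgue]_(x in cube a r) `|b x|%:E < +oo.
Proof. by move=> [_]; apply; exact: compact_cube. Qed.

Lemma BMO_of_oscillation b (C : R) : locally_L1 b ->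
  (forall a r, (0 < r)%R -> exists A,
    \int[lebesgue]_(x in cube a r) `|b x - A|%:E <= (C * r ^+ n)%:E) ->
  BMO b.
Proof.
move=> bL bC; split => //.
apply: (@le_lt_trans _ _ (2 * C)%:E); last exact: ltry.
apply: ge_ereal_sup => _ [[a r] /= r0 <-].
have [A bA] := bC a r r0.
have w0 : (0 < r ^+ n)%R by exact: exprn_gt0.
have := average_oscillation_le A (measurable_cube a r) (lebesgue_cube a r0) w0
  bL.1 (locally_L1_cube a r bL).
move=> /le_trans/(_ (lee_wpmul2l _ bA)); rewrite lee_fin ler0n => /(_ isT) bm.
rewrite volume_cube//.
apply: le_trans (lee_wpmul2l _ bm) _; first by rewrite lee_fin invr_ge0 ltW.
rewrite -!EFinM lee_fin mulrA [X in (X <= _)%R]mulrC -!mulrA.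
by rewrite mulVKf ?gt_eqF// mulrC.
Qed.

End bounded_mean_oscillation.

(** * Geometry of translated cubes *)

Section shifted_cubes.
Context {R : realType} {n : nat}.
Implicit Types (a c v : 'rV[R]_n) (r d L : R).
Local Open Scope ring_scope.

Lemma cube_shift_subset a v r L : (forall i, `|v ord0 i| <= L) ->
  cube (a - v) r `<=` cube (a - const_mx L) (2 * L + r).
Proof.
move=> vL x ax i; have := ax i; have := vL i; rewrite !mxE ler_norml.
by move=> /andP[? ?] /andP[? ?]; apply/andP; split; lra.
Qed.

Lemma cube_subset a r L : 0 <= L ->
  cube a r `<=` cube (a - const_mx L) (2 * L + r).
Proof.
move=> L0; rewrite -[X in cube X](subr0 a); apply: cube_shift_subset => i.
by rewrite mxE normr0.
Qed.

(** In each coordinate, with [k] the shift, both [x - a] and [y - a + k] lie between 0 and [r].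
    Hence [x - y - k] has modulus at most [r], and scaling by [d / r] gives [d]. *)
Lemma cube_shift_diff a c r d x y : 0 < r -> 0 < d ->
  cube a r x -> cube (a - (r / d) *: c) r y ->
  forall i, `|d / r * (x ord0 i - y ord0 i) - c ord0 i| <= d.
Proof.
move=> r0 d0 ax ay i; have := ax i; have := ay i; rewrite !mxE.
set k := r / d * c ord0 i.
have -> : d / r * (x ord0 i - y ord0 i) - c ord0 i =
    d / r * (x ord0 i - y ord0 i - k).
  by rewrite /k; field; rewrite ?gt_eqF.
move=> h1 h2.
rewrite normrM gtr0_norm ?divr_gt0// mulrAC ler_pdivrMr// ler_pM2l//.
by rewrite ler_norml; move: h1 h2 => /andP[? ?] /andP[? ?]; apply/andP; split; lra.
Qed.

Lemma cube_shift_diff_row a (c : 'rV[R]_(n + n)) r d x y z : 0 < r -> 0 < d ->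
  cube a r x -> cube (a - (r / d) *: lsubmx c) r y ->
  cube (a - (r / d) *: rsubmx c) r z ->
  forall i, `|(d / r *: row_mx (x - y) (x - z)) ord0 i - c ord0 i| <= d.
Proof.
move=> r0 d0 ax ay az i; rewrite mxE.
have subE (u v : 'rV[R]_n) j : (u - v) ord0 j = u ord0 j - v ord0 j.
  by rewrite !mxE.
rewrite -[c]hsubmxK -(splitK i); case: (fintype.split i) => j /=.
  by rewrite !row_mxEl subE; exact: cube_shift_diff.
by rewrite !row_mxEr subE; exact: cube_shift_diff.
Qed.

End shifted_cubes.

(** * From the commutator bound to bounded mean oscillation *)

Section commutator_theorem.
Context {R : realType} {n : nat}.

(** Hoelder's inequality on [Q] brings in the associate norm of [\1_Q]; monotonicity then moves all
    three norms to the common set [F]. The modulus of [A] appears because [A] may be negative. *)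
Lemma bounded_commutator_integral_le (X1 X2 Y : bfspace R n)
    (D : ('rV[R]_n -> R) -> ('rV[R]_n -> R) -> 'rV[R]_n -> R) (A W : R)
    (Q E1 E2 F : set 'rV[R]_n) (f g : 'rV[R]_n -> R) :
  (forall f g, in_space X1 f -> in_space X2 g ->
    in_space Y (D f g) /\ Y (D f g) <= A%:E * X1 f * X2 g) ->
  measurable Q -> measurable E1 -> measurable E2 -> measurable F ->
  bounded_set F -> Q `<=` F -> E1 `<=` F -> E2 `<=` F ->
  associate_norm Y \1_F * X1 \1_F * X2 \1_F <= W%:E ->
  measurable_fun setT f -> measurable_fun setT g ->
  (forall x, `|f x| <= \1_E1 x)%R -> (forall x, `|g x| <= \1_E2 x)%R ->
  \int[lebesgue]_(x in Q) `|D f g x|%:E <= (`|A| * W)%:E.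
Proof.
move=> DA mQ mE1 mE2 mF bF QF E1F E2F WF mf mg fE gE.
have fF x : (`|f x| <= \1_F x)%R.
  apply: le_trans (fE x) _; rewrite !indicE.
  by case: (boolP (x \in E1)) => [/set_mem/E1F/mem_set ->|].
have gF x : (`|g x| <= \1_F x)%R.
  apply: le_trans (gE x) _; rewrite !indicE.
  by case: (boolP (x \in E2)) => [/set_mem/E2F/mem_set ->|].
have [Xf f1] := in_space_dominated X1 mF bF mf fF.
have [Xg g1] := in_space_dominated X2 mF bF mg gF.
have [YD DA1] := DA _ _ Xf Xg.
have f0 := bfs_norm_ge0 Xf; have g0 := bfs_norm_ge0 Xg.
apply: le_trans (integral_le_associate_norm mQ YD) _.
rewrite EFinM.
apply: (@le_trans _ _ (`|A|%:E * (X1 f * X2 g) * associate_norm Y \1_F)).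
  apply: lee_pmul; [exact: bfs_norm_ge0|exact: associate_norm_ge0| |].
  - apply: le_trans DA1 _; rewrite -muleA; apply: lee_wpmul2r.
      exact: mule_ge0.
    by rewrite lee_fin ler_norm.
  - exact: associate_norm_indic_le.
rewrite -muleA; apply: lee_wpmul2l; first by rewrite lee_fin.
apply: le_trans WF; rewrite muleC -muleA; apply: lee_wpmul2l.
  exact: associate_norm_ge0.
exact: lee_pmul.
Qed.

Lemma cube_norms_le (X1 X2 Y : bfspace R n) (C v e : R) (F : set 'rV[R]_n) :
  (0 < v)%R ->
  (v `^ (- e))%:E * associate_norm Y \1_F * X1 \1_F * X2 \1_F <= (C * v)%:E ->
  associate_norm Y \1_F * X1 \1_F * X2 \1_F <= (v `^ e * (C * v))%:E.
Proof.
move=> v0; have ve0 : (0 < v `^ e)%R by exact: powR_gt0.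
by rewrite powRN -!muleA => h; rewrite EFinM -lee_pdivrMl.
Qed.

End commutator_theorem.

Lemma BMO_of_bounded_commutator (R : realType) (n : nat)
    (X1 X2 Y : bfspace R n) (alpha : R)
    (T : ('rV[R]_n -> R) -> ('rV[R]_n -> R) -> 'rV[R]_n -> R)
    (K : 'rV[R]_(n + n) -> R) (b : 'rV[R]_n -> R) (side : bool) : (0 < n)%N ->
  (exists C : R, forall (a : 'rV[R]_n) (r : R), (0 < r)%R ->
     let Q := cube a r in
     (volume Q `^ (- (alpha / n%:R)))%:E * associate_norm Y \1_Q *
       X1 \1_Q * X2 \1_Q <= (C * volume Q)%:E) ->
  (forall f g, in_space X1 f -> in_space X2 g -> represented_by K T f g) ->
  homogeneous (- ((2 * n)%:R - alpha)) K ->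
  (exists (c : 'rV[R]_(n + n)) (rho : R),
     (0 < rho)%R /\ inv_abs_fourier K (euclidean_ball c rho)) ->
  locally_L1 b ->
  (forall f g, in_space X1 f -> in_space X2 g ->
    if side then represented_by K T (fun y => b y * f y)%R g
    else represented_by K T f (fun z => b z * g z)%R) ->
  bounded_from X1 X2 Y (commutator side b T) -> BMO b.
Proof.
move=> n0 [C CC] KT Khom [c0 [rho [rho0 Kc0]]] bL bKT [A DA].
have nn0 : (0 < n + n)%N by rewrite addn_gt0 n0.
have [S [p [q [nu [c [d [pqS d0 [i0 ci0] KP]]]]]]] :=
  inv_abs_fourier_approx nn0 rho0 Kc0.
set s := ((2 * n)%:R - alpha)%R in Khom.
(* [r * L] dominates every coordinate of the shift [(r / d) *: c], so a cube of side [l * r]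
   contains [Q] and both translates. *)
pose L := ((\sum_i `|c ord0 i|) / d)%R.
have cL i : (`|c ord0 i| / d <= L)%R.
  rewrite ler_pM2r ?invr_gt0//.
  rewrite (bigD1 i)//= lerDl; exact: sumr_ge0.
have L0 : (0 <= L)%R by apply: le_trans (cL i0); rewrite divr_ge0// ltW.
pose l := (2 * L + 1)%R.
have l0 : (0 < l)%R by rewrite ltr_wpDl// mulr_ge0.
(* The factor [4 * S] comes from the oscillation bound, the modulus of [A] from the commutator, [C]
   and the powers of [l] from the cube condition on [F], and the power of [d] from dividing by
   [M]. *)
apply: (@BMO_of_oscillation _ _ b
  (4 * S * `|A| * C * l `^ alpha * l ^+ n * d `^ (- s))%R bL) => a r r0.
pose t := (d / r)%R; have t0 : (0 < t)%R by rewrite divr_gt0.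
(* By homogeneity [K (t *: u) = K u / M], so the approximation of 1 multiplied by [M] compares [M]
   with [K u] times the polynomial at [t *: u]. *)
pose M := (t `^ s)%R; have M0 : (0 < M)%R by exact: powR_gt0.
pose w := (r ^+ n)%R; have w0 : (0 < w)%R by exact: exprn_gt0.
pose E1 := cube (a - (r / d) *: lsubmx c)%R r.
pose E2 := cube (a - (r / d) *: rsubmx c)%R r.
pose F := cube (a - const_mx (r * L))%R (2 * (r * L) + r)%R.
have rd i : (`|r / d * c ord0 i| <= r * L)%R.
  rewrite normrM gtr0_norm ?divr_gt0// -mulrA ler_pM2l// mulrC.
  exact: cL.
have QF : cube a r `<=` F by apply: cube_subset; rewrite mulr_ge0// ltW.
have E1F : E1 `<=` F.
  by apply: cube_shift_subset => i; rewrite !mxE; exact: rd.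
have E2F : E2 `<=` F.
  by apply: cube_shift_subset => i; rewrite !mxE; exact: rd.
have near_c x y z : cube a r x -> E1 y -> E2 z -> forall i,
    (`|(t *: row_mx (x - y) (x - z)) ord0 i - c ord0 i| <= d)%R.
  exact: cube_shift_diff_row.
(* The coordinate [i0] of the zero vector is farther than [d] from that of [c]. This serves twice:
   homogeneity requires a nonzero vector, and the cubes must have no common point. *)
have off_diag x y z : cube a r x -> E1 y -> E2 z ->
    row_mx (x - y)%R (x - z)%R != 0%R.
  move=> Qx Ey Ez; apply/eqP => u0.
  have := near_c x y z Qx Ey Ez i0.
  by rewrite u0 scaler0 mxE sub0r normrN leNgt ci0.
have lr : (2 * (r * L) + r = l * r)%R by rewrite /l; ring.
have lr0 : (0 < l * r)%R by exact: mulr_gt0.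
have vF : (volume F = (l * r) ^+ n)%R by rewrite volume_cube lr.
pose W := (volume F `^ (alpha / n%:R) * (C * volume F))%R.
have WF : associate_norm Y \1_F * X1 \1_F * X2 \1_F <= W%:E.
  apply: cube_norms_le; first by rewrite vF exprn_gt0.
  by apply: CC; rewrite lr.
have mE := @measurable_cube R n.
have bE a' : lebesgue.-integrable setT (EFin \o (fun y => b y * \1_(cube a' r) y)%R).
  by apply: integrable_indicM; [exact: mE|exact: bL.1|exact: locally_L1_cube].
have bE12 : lebesgue.-integrable setT
    (EFin \o (fun y => b y * \1_(if side then E1 else E2) y)%R).
  by case: side {bKT DA}; exact: bE.
exists (w^-1 * \int[lebesgue]_y (b y * \1_(if side then E1 else E2) y))%R.
have Mw0 : (0 < M * w ^+ 2)%R by rewrite mulr_gt0 ?exprn_gt0.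
have Mw0' : 0 < (M * w ^+ 2)%:E by rewrite lte_fin.
rewrite -(lee_pmul2l _ Mw0')//.
apply: le_trans (@oscillation_le R n side K b E1 E2 w t M p q nu (mE _ _)
  (mE _ _) (lebesgue_cube _ r0) (lebesgue_cube _ r0) w0 M0 bE12 (cube a r) S
  (`|A| * W)%R (commutator side b T) (mE _ _) (lebesgue_cube _ r0) bL.1
  (locally_L1_cube _ _ bL) pqS _ _) _.
- move=> j e; set f := trig_test _ _ _ _; set g := trig_test _ _ _ _.
  have mf : measurable_fun setT f by exact/measurable_trig_test/mE.
  have mg : measurable_fun setT g by exact/measurable_trig_test/mE.
  have fE x : (`|f x| <= \1_E1 x)%R by exact: norm_trig_test_le.
  have gE x : (`|g x| <= \1_E2 x)%R by exact: norm_trig_test_le.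
  have [Xf _] := in_space_dominated X1 (mE _ _) (bounded_cube _ _) mf fE.
  have [Xg _] := in_space_dominated X2 (mE _ _) (bounded_cube _ _) mg gE.
  split.
  + exact: (DA _ _ Xf Xg).1.1.
  + exact: (bounded_commutator_integral_le DA (mE _ _) (mE _ _) (mE _ _) (mE _ _)
      (bounded_cube _ _) QF E1F E2F WF mf mg fE gE).
  + move=> x Qx; apply: commutator_has_iint; [exact: KT|exact: bKT|].
    (* If [x] lay in both supports, [y = z = x] would be allowed in [off_diag], where the row
       vanishes. *)
    move=> [xf xg].
    have xE1 : E1 x.
      apply: supp_subset xf => [|y yE]; first exact: closed_cube.
      by apply/eqP; rewrite -normr_le0 (le_trans (fE y))// indicE memNset.
    have xE2 : E2 x.
      apply: supp_subset xg => [|y yE]; first exact: closed_cube.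
      by apply/eqP; rewrite -normr_le0 (le_trans (gE y))// indicE memNset.
    by have := off_diag _ _ _ Qx xE1 xE2; rewrite !subrr row_mx0 eqxx.
- move=> eps eps0; have [N KN] := KP (eps / M)%R (divr_gt0 eps0 M0).
  exists N => x y z Qx Ey Ez; have u0 := off_diag _ _ _ Qx Ey Ez.
  have := KN _ (near_c _ _ _ Qx Ey Ez).
  rewrite Khom// powRN -/M ler_pdivlMr// -[X in (_ * X <= _)%R -> _](gtr0_norm M0).
  rewrite -normrM; congr (`|_| <= _)%R.
  by field; rewrite gt_eqF.
rewrite -EFinM lee_fin.
(* What remains is counting powers of [r]: [W] carries the exponent [alpha + n] and [M * w ^+ 2] the
   exponent [alpha], which leaves [r ^+ n]. *)
have Wr : (W = C * l `^ alpha * l ^+ n * (r `^ alpha * w))%R.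
  rewrite /W vF -powR_mulrn ?(ltW lr0)// -powRrM.
  have -> : (n%:R * (alpha / n%:R) = alpha)%R.
    by field; rewrite pnatr_eq0 -lt0n.
  rewrite powR_mulrn ?(ltW lr0)//.
  by rewrite powRM ?(ltW l0) ?(ltW r0)// exprMn /w; ring.
have Mr : (M = d `^ s * r `^ (- s))%R.
  rewrite /M /t powRM ?invr_ge0 ?(ltW d0) ?(ltW r0)//.
  by rewrite -(powR_inv1 (ltW r0)) -powRrM mulN1r.
have rs : (r `^ (- s) * w ^+ 2 = r `^ alpha)%R.
  rewrite -exprM -powR_mulrn ?(ltW r0)// -powRD; last first.
    by rewrite (gt_eqF r0) implybT.
  by congr (_ `^ _)%R; rewrite /s mulnC; ring.
have ds : (d `^ s * d `^ (- s) = 1)%R.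
  by rewrite powRN mulfV// gt_eqF// powR_gt0.
have Mw : (M * w ^+ 2 = d `^ s * r `^ alpha)%R by rewrite Mr -mulrA rs.
rewrite Wr Mw -/w -[leLHS]mul1r -ds le_eqVlt; apply/orP; left; apply/eqP.
ring.
Qed.

Theorem theorem1p2 (R : realType) (n : nat) (X1 X2 Y : bfspace R n)
    (alpha : R)
    (T : ('rV[R]_n -> R) -> ('rV[R]_n -> R) -> 'rV[R]_n -> R)
    (K : 'rV[R]_(n + n) -> R) (b : 'rV[R]_n -> R)
  (alpha_range : (0 <= alpha < (2 * n)%:R)%R)
  (cube_bound : exists C : R, forall (a : 'rV[R]_n) (r : R), (0 < r)%R ->
     let Q := cube a r in
     (volume Q `^ (- (alpha / n%:R)))%:E * associate_norm Y \1_Q *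
       X1 \1_Q * X2 \1_Q <= (C * volume Q)%:E)
  (T_bilinear : bilinear_on X1 X2 T)
  (T_repr : forall f g, in_space X1 f -> in_space X2 g ->
     represented_by K T f g)
  (K_homogeneous : homogeneous (- ((2 * n)%:R - alpha)) K)
  (K_fourier : exists (c : 'rV[R]_(n + n)) (rho : R),
     (0 < rho)%R /\ inv_abs_fourier K (euclidean_ball c rho))
  (b_L1loc : locally_L1 b)
  (commutator_bounded :
     ((forall f g, in_space X1 f -> in_space X2 g ->
         represented_by K T (fun y => b y * f y)%R g) /\
      bounded_from X1 X2 Y (commutator1 b T)) \/
     ((forall f g, in_space X1 f -> in_space X2 g ->
         represented_by K T f (fun z => b z * g z)%R) /\
      bounded_from X1 X2 Y (commutator2 b T))) :
  BMO b.
Proof.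
(* The range of [alpha] is empty in dimension 0. *)
have n0 : (0 < n)%N.
  by have /andP[/le_lt_trans/[apply]] := alpha_range; rewrite ltr0n muln_gt0.
have BMO_b side := BMO_of_bounded_commutator (side := side) n0 cube_bound
  T_repr K_homogeneous K_fourier b_L1loc.
by case: commutator_bounded => -[bT bounded];
  [exact: (BMO_b true)|exact: (BMO_b false)].
Qed.
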